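(* Let $K\subseteq\mathbb{R}^n$ be compact and let $\mathbb{I}=\{\mathbb{I}_1,\dots,\mathbb{I}_N\}$ be a random iterated function system on $K$ in which every map $S_{i,j}$ is a similarity contraction with ratio $\mathrm{Lip}(S_{i,j})\in(0,1)$. For each $i$, let $s_i$ be the unique solution of $\sum_{j\in\mathcal{I}_i}\mathrm{Lip}(S_{i,j})^{s_i}=1$, and write $s_{\min}=\min_is_i$, $s_{\max}=\max_is_i$. Assume $\mathbb{I}$ satisfies the uniform open set condition. Then (1) $0<\sup_{\omega\in\Omega}\mathcal{P}^{s_{\max}}(F_\omega)<\infty$; (2) $\sup_{\omega\in\Omega}\dim_{\mathrm P}F_\omega=\sup_{\omega\in\Omega}\overline{\dim}_{\mathrm B}F_\omega=s_{\max}$; (3) $0<\inf_{\omega\in\Omega}\mathcal{H}^{s_{\min}}(F_\omega)<\infty$; (4) $\inf_{\omega\in\Omega}\dim_{\mathrm H}F_\omega=\inf_{\omega\in\Omega}\underline{\dim}_{\mathrm B}F_\omega=s_{\min}$.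
   Context: Here $\mathbb{I}_i=\{S_{i,j}\}_{j\in\mathcal{I}_i}$ with $\mathcal{I}_i$ finite nonempty and each $S_{i,j}:K\to K$ (the restriction of) a similarity of $\mathbb{R}^n$, i.e. $|S_{i,j}x-S_{i,j}y|=\mathrm{Lip}(S_{i,j})|x-y|$. $\Omega=\{1,\dots,N\}^{\mathbb{N}}$ and for $\omega\in\Omega$, $F_\omega=\bigcap_k\bigcup_{i_1\in\mathcal{I}_{\omega_1},\dots,i_k\in\mathcal{I}_{\omega_k}}S_{\omega_1,i_1}\circ\cdots\circ S_{\omega_k,i_k}(K)$. The uniform open set condition holds if there is a nonempty open set $\mathcal{O}\subseteq K$ such that for each $i$, $\bigcup_{j\in\mathcal{I}_i}S_{i,j}(\mathcal{O})\subseteq\mathcal{O}$ with the union disjoint. $\mathcal{H}^s$, $\mathcal{P}^s$ are $s$-dimensional Hausdorff and packing measures; $\dim_{\mathrm H},\dim_{\mathrm P},\underline{\dim}_{\mathrm B},\overline{\dim}_{\mathrm B}$ are Hausdorff, packing, lower and upper box dimension. *)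

(* Defs.v *)
From mathcomp Require Import all_boot all_algebra.
From mathcomp Require Import all_classical all_reals all_analysis.
Import GRing.Theory Num.Theory numFieldNormedType.Exports.
Set Implicit Arguments. Unset Strict Implicit. Unset Printing Implicit Defensive.
Local Open Scope classical_set_scope.
Local Open Scope ring_scope.

Section FractalDefs.
Context {R : realType} {n : nat}.
Local Notation pt := 'rV[R]_n.

Definition eucl_dist (x y : pt) : R :=
  Num.sqrt (\sum_(i < n) (x ord0 i - y ord0 i) ^+ 2).

(** diameter (diam of the empty set is 0; may be +oo) *)
Definition ediam (A : set pt) : \bar R :=
  ereal_sup ([set 0%E] `|`
    [set d | exists x y, A x /\ A y /\ d = (eucl_dist x y)%:E]).

Definition cball (c : pt) (r : R) : set pt := [set y | eucl_dist c y <= r].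

(** |U|^s, with the convention that empty sets contribute 0
    (and 0^0 = 1 for nonempty singletons, so H^0 is counting measure) *)
Definition hterm (s : R) (U : set pt) : \bar R :=
  if `[< U = set0 >] then 0%E else ((fine (ediam U)) `^ s)%:E.

Definition hcontent (delta s : R) (F : set pt) : \bar R :=
  ereal_inf [set (\sum_(0 <= k <oo) hterm s (U k))%E |
     U in [set U : nat -> set pt |
        F `<=` \bigcup_k U k /\ forall k, (ediam (U k) <= delta%:E)%E]].

Definition hausdorff_measure (s : R) (F : set pt) : \bar R :=
  ereal_sup [set hcontent delta s F | delta in [set d : R | 0 < d]].

Definition hausdorff_dim (F : set pt) : \bar R :=
  ereal_inf [set s%:E | s in [set s : R | 0 <= s /\ hausdorff_measure s F = 0%E]].

(** delta-packings of F: countable (possibly finite: None entries)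
    families of pairwise disjoint closed balls with centres in F and
    radii at most delta *)
Definition is_packing (delta : R) (F : set pt) (B : nat -> option (pt * R)) :=
  (forall k c r, B k = Some (c, r) -> F c /\ 0 < r <= delta) /\
  (forall k l c r c' r', k <> l -> B k = Some (c, r) -> B l = Some (c', r') ->
      cball c r `&` cball c' r' = set0).

Definition pterm (s : R) (b : option (pt * R)) : \bar R :=
  if b is Some (c, r) then hterm s (cball c r) else 0%E.

Definition packing_pre_delta (delta s : R) (F : set pt) : \bar R :=
  ereal_sup [set (\sum_(0 <= k <oo) pterm s (B k))%E | B in is_packing delta F].

Definition packing_pre (s : R) (F : set pt) : \bar R :=
  ereal_inf [set packing_pre_delta delta s F | delta in [set d : R | 0 < d]].

Definition packing_measure (s : R) (F : set pt) : \bar R :=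
  ereal_inf [set (\sum_(0 <= k <oo) packing_pre s (G k))%E |
     G in [set G : nat -> set pt | F `<=` \bigcup_k G k]].

Definition packing_dim (F : set pt) : \bar R :=
  ereal_inf [set s%:E | s in [set s : R | 0 <= s /\ packing_measure s F = 0%E]].

Definition covnum (delta : R) (F : set pt) : \bar R :=
  ereal_inf [set (m%:R)%:E | m in [set m : nat | exists U : nat -> set pt,
     F `<=` \bigcup_(k in `I_m) U k /\ forall k, (ediam (U k) <= delta%:E)%E]].

Definition box_ratio (delta : R) (F : set pt) : R :=
  ln (fine (covnum delta F)) / (- ln delta).

Definition upper_box_dim (F : set pt) : \bar R :=
  ereal_inf [set ereal_sup [set (box_ratio d F)%:E | d in [set d : R | 0 < d < e]]
            | e in [set e : R | 0 < e < 1]].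

Definition lower_box_dim (F : set pt) : \bar R :=
  ereal_sup [set ereal_inf [set (box_ratio d F)%:E | d in [set d : R | 0 < d < e]]
            | e in [set e : R | 0 < e < 1]].

Section RIFS.
Variables (N : nat) (m : 'I_N -> nat) (S : forall i : 'I_N, 'I_(m i) -> pt -> pt)
          (K : set pt).

(** level-k set: union over i_1..i_k of S_{w_1,i_1} o ... o S_{w_k,i_k}(K)
    (sequences w are indexed from 0) *)
Fixpoint rifs_level (k : nat) (w : nat -> 'I_N) : set pt :=
  match k with
  | 0 => K
  | k'.+1 => \bigcup_(j in [set: 'I_(m (w 0%N))])
               (@S (w 0%N) j @` rifs_level k' (fun t => w t.+1))
  end.

Definition rifs_attractor (w : nat -> 'I_N) : set pt :=
  \bigcap_k rifs_level k w.

Definition uniform_OSC : Prop :=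
  exists O : set pt, open O /\ O !=set0 /\ O `<=` K /\
    forall i : 'I_N, (forall j, @S i j @` O `<=` O) /\
      (forall j j', j != j' -> @S i j @` O `&` @S i j' @` O = set0).
End RIFS.

End FractalDefs.

(* Main.v *)
Require Import Defs.
From mathcomp Require Import all_boot all_order all_algebra.
From mathcomp Require Import all_classical all_reals all_analysis.
From mathcomp Require Import ring lra.
Import Order.TTheory GRing.Theory Num.Theory numFieldNormedType.Exports.
Local Open Scope classical_set_scope.
Local Open Scope ring_scope.
Set Implicit Arguments. Unset Strict Implicit. Unset Printing Implicit Defensive.

(* A word [w] carries the Bernoulli weights [\prod_k r (w k) j_k `^ s (w k)], and
   "stopping" a word when its ratio drops to [rho / D] cuts the attractor into
   cylinders of diameter comparable to [rho] and total weight 1.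
   - If [s (w k) <= t] for all [k], each weight is at least the ratio to the power
     [t]; counting cylinders bounds the covering numbers, and a disjoint family of
     balls contains disjoint cylinders of comparable size, which bounds every
     packing sum.
   - If [t <= s (w k)] for all [k], each weight is at most the ratio to the power
     [t], and by the open set condition a ball of radius [rho] meets a bounded
     number of cylinders of scale [rho], since each contains a ball of comparable
     radius inside disjoint copies of the open set. Hence a ball has mass at most
     [M * (rho / D) `^ t] and every cover has [t]-energy bounded below; packing
     measures are bounded below by comparing maximal packings with covers.
   All constants are independent of [w]. With [t] one of the extreme values, the
   constant words at which [s] is maximal or minimal show that the bounds are
   sharp. *)

(** * Euclidean geometry of row vectors *)

Section EuclideanSpace.
Context {R : realType} {n : nat}.
Implicit Types x y z : 'rV[R]_n.

Definition dot x y : R := (x *m y^T) ord0 ord0.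

Lemma dotE x y : dot x y = \sum_i x ord0 i * y ord0 i.
Proof. by rewrite /dot mxE; apply: eq_bigr => i _; rewrite mxE. Qed.

Lemma dotC x y : dot x y = dot y x.
Proof. by rewrite !dotE; apply: eq_bigr => i _; rewrite mulrC. Qed.

Lemma dotDl x y z : dot (x + y) z = dot x z + dot y z.
Proof. by rewrite /dot mulmxDl mxE. Qed.

Lemma dotZl a x y : dot (a *: x) y = a * dot x y.
Proof. by rewrite /dot -scalemxAl mxE. Qed.

Lemma dotNl x y : dot (- x) y = - dot x y.
Proof. by rewrite -scaleN1r dotZl mulN1r. Qed.

Lemma dotBB x y : dot (x - y) (x - y) = dot x x - dot x y *+ 2 + dot y y.
Proof.
rewrite dotDl dotNl ![dot _ (x - y)]dotC !dotDl !dotNl (dotC y x); ring.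
Qed.

Lemma dot_ge0 x : 0 <= dot x x.
Proof. by rewrite dotE sumr_ge0// => i _; rewrite -expr2 sqr_ge0. Qed.

Lemma eucl_distE x y : eucl_dist x y = Num.sqrt (dot (x - y) (x - y)).
Proof.
by rewrite /eucl_dist dotE; congr Num.sqrt; apply: eq_bigr => i _; rewrite !mxE.
Qed.

Lemma eucl_dist_ge0 x y : 0 <= eucl_dist x y.
Proof. exact: sqrtr_ge0. Qed.

Lemma eucl_dist_sqr x y : eucl_dist x y ^+ 2 = dot (x - y) (x - y).
Proof. by rewrite eucl_distE sqr_sqrtr ?dot_ge0. Qed.

Lemma eucl_dist_sym x y : eucl_dist x y = eucl_dist y x.
Proof.
rewrite /eucl_dist; congr Num.sqrt; apply: eq_bigr => i _.
by rewrite -sqrrN opprB.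
Qed.

Lemma eucl_distxx x : eucl_dist x x = 0.
Proof. by rewrite eucl_distE subrr /dot mul0mx mxE sqrtr0. Qed.

Lemma dot_eq0 x : dot x x = 0 -> x = 0.
Proof.
rewrite dotE => /eqP; rewrite psumr_eq0; last by move=> i _; rewrite -expr2 sqr_ge0.
move=> /allP h; apply/rowP => i; rewrite mxE.
by have := h i (mem_index_enum i); rewrite -expr2 sqrf_eq0 => /eqP.
Qed.

Lemma eucl_dist_eq0 x y : eucl_dist x y = 0 -> x = y.
Proof.
move=> h; apply/eqP; rewrite -subr_eq0; apply/eqP/dot_eq0.
by rewrite -eucl_dist_sqr h expr0n.
Qed.

(** The squared norm of [dot y y *: x - dot x y *: y] expands to [dot y y] times the gap between the
    two sides. *)
Lemma CauchySchwarz_dot x y : dot x y ^+ 2 <= dot x x * dot y y.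
Proof.
have [y0|yn0] := eqVneq y 0.
  by rewrite y0 dotC -(scale0r 0) !dotZl !mul0r mulr0 expr0n.
have yy : 0 < dot y y.
  by rewrite lt_neqAle dot_ge0 andbT eq_sym; apply: contra_neq yn0 => /dot_eq0.
have := dot_ge0 (dot y y *: x - dot x y *: y).
rewrite dotBB !dotZl ![dot _ (_ *: _)]dotC !dotZl (dotC y x) => h.
rewrite -subr_ge0 -(pmulr_rge0 _ yy); apply: le_trans h _.
by rewrite le_eqVlt; apply/orP; left; apply/eqP; ring.
Qed.

Lemma eucl_dist_triangle y x z :
  eucl_dist x z <= eucl_dist x y + eucl_dist y z.
Proof.
rewrite -(@ler_pXn2r _ 2) ?nnegrE ?addr_ge0 ?eucl_dist_ge0//.
rewrite sqrrD !eucl_dist_sqr.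
have -> : x - z = (x - y) - (z - y) by rewrite opprB addrA subrK.
rewrite -[y - z]opprB.
set u := x - y; set v := z - y.
have NN w : dot (- w) (- w) = dot w w by rewrite dotNl dotC dotNl opprK.
rewrite dotBB NN.
have uv : `|dot u v| <= eucl_dist x y * eucl_dist y z.
  rewrite -(@ler_pXn2r _ 2) ?nnegrE ?mulr_ge0 ?eucl_dist_ge0//.
  rewrite real_normK ?num_real// exprMn !eucl_dist_sqr.
  by rewrite -[y - z]opprB NN; exact: CauchySchwarz_dot.
rewrite -normrN in uv; have := le_trans (ler_norm _) uv => {}uv.
lra.
Qed.

Lemma coord_le_eucl_dist x y i : `|x ord0 i - y ord0 i| <= eucl_dist x y.
Proof.
rewrite -sqrtr_sqr ler_sqrt; last by apply: sumr_ge0 => j _; exact: sqr_ge0.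
by rewrite (bigD1 i)//= lerDl sumr_ge0// => j _; exact: sqr_ge0.
Qed.

(** The crude factor [n.+1] exceeds the square root of [n] and keeps the inequality strict in
    dimension 0. *)
Lemma eucl_dist_lt_coord (e : R) x y : 0 < e ->
  (forall i, `|x ord0 i - y ord0 i| <= e) -> eucl_dist x y < n.+1%:R * e.
Proof.
move=> e0 xy.
rewrite -(@ltr_pXn2r _ 2) ?nnegrE ?eucl_dist_ge0 ?mulr_ge0 ?ltW//.
rewrite sqr_sqrtr; last by apply: sumr_ge0 => j _; exact: sqr_ge0.
apply: (@le_lt_trans _ _ (\sum_(i < n) e ^+ 2)).
  apply: ler_sum => i _; rewrite -(real_normK (num_real _)).
  by rewrite ler_pXn2r ?nnegrE// ltW.
rewrite sumr_const card_ord -(mulr_natl (e ^+ 2)) exprMn ltr_pM2r ?exprn_gt0//.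
by rewrite -natrX ltr_nat expnS expn1 (leq_trans (ltnSn n))// leq_pmulr.
Qed.

Lemma eucl_dist_homothety c (e : R) x y : 0 <= e ->
  eucl_dist (c + e *: x) (c + e *: y) = e * eucl_dist x y.
Proof.
move=> e0; rewrite !eucl_distE opprD addrACA subrr add0r -scalerBr.
by rewrite dotZl dotC dotZl mulrA -expr2 sqrtrM ?sqr_ge0// sqrtr_sqr ger0_norm.
Qed.

Definition eball x (e : R) : set 'rV[R]_n := [set y | eucl_dist x y < e].

Lemma nbhs_eball x (e : R) : 0 < e -> nbhs x (eball x e).
Proof.
move=> e0; apply/nbhs_ballP; exists (e / n.+1%:R) => /=; first by rewrite divr_gt0.
move=> y [_ xy]; rewrite /eball /=.
rewrite -[ltRHS](@divfK _ n.+1%:R)// [ltRHS]mulrC.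
apply: eucl_dist_lt_coord => [|i]; first by rewrite divr_gt0.
exact/ltW/xy.
Qed.

Lemma open_eball x (e : R) : open (eball x e).
Proof.
rewrite openE => y xy; rewrite /interior.
have e0 : 0 < e - eucl_dist x y by rewrite subr_gt0.
move: (nbhs_eball y e0); apply: filterS => z yz.
by rewrite /eball/= (le_lt_trans (eucl_dist_triangle y _ _))// -ltrBrDl.
Qed.

Lemma open_eball_sub (U : set 'rV[R]_n) x : open U -> U x ->
  exists2 e, 0 < e & eball x e `<=` U.
Proof.
rewrite openE => oU /oU /nbhs_ballP[e /= e0 eU]; exists e => //.
move=> y xy; apply: eU; split => // i j.
rewrite !ord1; exact: le_lt_trans (coord_le_eucl_dist _ _ _) xy.
Qed.

Lemma compact_eucl_bounded (K : set 'rV[R]_n) : compact K ->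
  exists2 D, 0 < D & forall x y, K x -> K y -> eucl_dist x y <= D.
Proof.
move=> /compact_bounded[M [_ KM]].
have M0 : 0 < `|M| + 1 by rewrite ltr_wpDl.
exists (n.+1%:R * ((`|M| + 1) *+ 2)); first by rewrite mulr_gt0 ?pmulrn_lgt0.
have coord x : K x -> forall i, `|x ord0 i| <= `|M| + 1.
  move=> Kx i; apply: (@le_trans _ _ `|x|).
    rewrite [leRHS]/Num.Def.normr/= mx_normrE.
    exact: (le_bigmax _ (fun ij : 'I_1 * 'I_n => `|x ij.1 ij.2|) (ord0, i)).
  by apply: KM => //; rewrite (le_lt_trans (ler_norm M))// ltrDl.
move=> x y Kx Ky; apply/ltW/eucl_dist_lt_coord => [|i]; first by rewrite pmulrn_lgt0.
by rewrite (le_trans (ler_normB _ _))// mulr2n lerD// coord.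
Qed.

Lemma eball_finite_net (C e : R) : 0 < C -> 0 < e ->
  exists Q : seq 'rV[R]_n, forall y, eucl_dist 0 y <= C ->
    exists2 q, q \in Q & eucl_dist q y < e.
Proof.
move=> C0 e0; pose h := e / n.+1%:R.
have h0 : 0 < h by rewrite divr_gt0.
(* A grid of mesh [h] on the cube of half-side [C]: each [y ord0 i + C] lies between 0 and [C + C],
   so its index is below [L]. *)
pose L := (Num.truncn ((C + C) / h)).+1.
pose q (f : {ffun 'I_n -> 'I_L}) : 'rV[R]_n := \row_i (h * (f i)%:R - C).
exists [seq q f | f : {ffun 'I_n -> 'I_L}] => y yC.
have yi i : 0 <= (y ord0 i + C) / h <= (C + C) / h.
  have := le_trans (coord_le_eucl_dist 0 y i) yC.
  rewrite mxE sub0r normrN ler_norml => /andP[y1 y2].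
  by rewrite divr_ge0 ?(ltW h0)//= ?ler_pM2r ?invr_gt0//; lra.
have fL i : (Num.truncn ((y ord0 i + C) / h)%R < L)%N.
  by rewrite ltnS; apply: le_truncn; have /andP[] := yi i.
exists (q [ffun i => Ordinal (fL i)]); first by apply: map_f; rewrite mem_enum.
rewrite -[ltRHS](@divfK _ n.+1%:R)// [ltRHS]mulrC -/h.
apply: eucl_dist_lt_coord => // i; rewrite mxE ffunE/=.
have /andP[y0 _] := yi i; have /andP[] := truncn_itv y0.
set k := Num.truncn _ => k1 k2.
have -> : h * k%:R - C - y ord0 i = h * (k%:R - (y ord0 i + C) / h).
  by field; rewrite gt_eqF.
rewrite normrM gtr0_norm// ler_piMr ?(ltW h0)// ler_norml.
by move: k2; rewrite -natr1; lra.
Qed.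

(** One list of offsets serves every centre and every scale; its length will bound the number of
    cylinders of scale [rho] that meet a ball of radius [rho]. *)
Lemma homothetic_net (C e : R) : 0 < C -> 0 < e ->
  exists Q : seq 'rV[R]_n, forall c rho y, 0 < rho -> eucl_dist c y <= rho * C ->
    exists2 q, q \in Q & eucl_dist (c + rho *: q) y < rho * e.
Proof.
move=> C0 e0; have [Q QP] := eball_finite_net C0 e0.
exists Q => c rho y rho0 cy.
have yE : y = c + rho *: (rho^-1 *: (y - c)).
  by rewrite scalerA divff ?gt_eqF// scale1r addrC subrK.
rewrite {1}[y]yE -[X in eucl_dist X _]addr0 -(scaler0 _ rho) in cy.
rewrite eucl_dist_homothety ?(ltW rho0)// ler_pM2l// in cy.
have [q qQ qy] := QP _ cy; exists q => //.
by rewrite {1}[y]yE eucl_dist_homothety ?(ltW rho0)// ltr_pM2l.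
Qed.

End EuclideanSpace.

(** * Similarities of Euclidean space *)

Section Similarity.
Context {R : realType} {n : nat}.
Implicit Types (x y : 'rV[R]_n) (f g : 'rV[R]_n -> 'rV[R]_n).

Definition similarity (a : R) f :=
  0 < a /\ forall x y, eucl_dist (f x) (f y) = a * eucl_dist x y.

Lemma similarity_id : similarity 1 id.
Proof. by split=> // x y; rewrite mul1r. Qed.

Lemma similarity_comp a b f g :
  similarity a f -> similarity b g -> similarity (a * b) (f \o g).
Proof.
by move=> [a0 fa] [b0 gb]; split=> [|x y]; rewrite ?mulr_gt0//= fa gb mulrA.
Qed.

Lemma similarity_inj a f : similarity a f -> injective f.
Proof.
move=> [a0 fa] x y fxy; apply: eucl_dist_eq0; apply/eqP.
have /eqP := fa x y; rewrite fxy eucl_distxx eq_sym mulf_eq0 => /orP[/eqP a00|//].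
by rewrite a00 ltxx in a0.
Qed.

Lemma similarity_continuous a f : similarity a f -> continuous f.
Proof.
move=> [a0 fa] x B /nbhs_ballP[e /= e0 eB].
have c0 : 0 < e / a by rewrite divr_gt0.
apply: (@filterS _ (nbhs x) _ _ _ _ (nbhs_eball x c0)) => y.
rewrite /eball/= ltr_pdivlMr// mulrC -fa => xy; apply: eB; split=> // i j.
by rewrite !ord1; exact: le_lt_trans (coord_le_eucl_dist _ _ _) xy.
Qed.

(* By polarization [h x = f x - f 0] preserves the inner product up to the
   factor [a ^+ 2], hence the matrix [A] of the images of the basis vectors
   satisfies [A *m A^T = a ^+ 2], and a one-sided inverse is two-sided. *)
Lemma similarity_surj a f : similarity a f -> forall y, exists x, f x = y.
Proof.
move=> [a0 fa] y; pose h x := f x - f 0.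
have hh x z : dot (h x) (h z) = a ^+ 2 * dot x z.
  have E u v : dot (f u - f v) (f u - f v) = a ^+ 2 * dot (u - v) (u - v).
    by rewrite -!eucl_dist_sqr fa exprMn.
  have := E x 0; have := E z 0; have := E x z.
  rewrite !subr0 -/(h x) -/(h z).
  have -> : f x - f z = h x - h z by rewrite /h opprB addrA subrK.
  rewrite !dotBB => Exz Ez Ex; rewrite Ex Ez in Exz.
  lra.
pose A := \matrix_i h (delta_mx ord0 i).
have hA x : h x *m A^T = a ^+ 2 *: x.
  apply/rowP => i; rewrite !mxE.
  transitivity (dot (h x) (h (delta_mx ord0 i))).
    by rewrite dotE; apply: eq_bigr => j _; rewrite !mxE.
  rewrite hh dotE (bigD1 i)//= big1 ?addr0.
    by rewrite mxE !eqxx mulr1.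
  by move=> j ji; rewrite mxE (negbTE ji) andbF mulr0.
have a2 : a ^+ 2 != 0 by rewrite expf_neq0// gt_eqF.
have AAT : A *m (a ^- 2 *: A^T) = 1%:M.
  apply/row_matrixP => i.
  rewrite row_mul rowK -scalemxAr hA scalerA mulVf// scale1r.
  by apply/rowP => j; rewrite !mxE eqxx eq_sym.
have {}AAT := mulmx1C AAT.
exists (a ^- 2 *: ((y - f 0) *m A^T)); set x := a ^- 2 *: _.
suff : h x = y - f 0 by move/addIr.
rewrite -[h x]mulmx1 -[RHS]mulmx1 -AAT -!scalemxAl -!scalemxAr !mulmxA hA /x.
by rewrite scalerA divff// scale1r.
Qed.

(** Surjectivity makes the image of a ball a full ball, so a cylinder contains a ball of radius
    proportional to its ratio. *)
Lemma similarity_eball a f x (e : R) : similarity a f ->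
  eball (f x) (a * e) `<=` f @` eball x e.
Proof.
move=> af y xy; have [z fz] := similarity_surj af y.
exists z => //; move: xy; rewrite -fz /eball/=.
by case: af => a0 ->; rewrite ltr_pM2l.
Qed.

End Similarity.

(** * Series, diameters and the terms of Hausdorff sums *)

Section FractalMeasures.
Context {R : realType} {n : nat}.
Local Notation pt := 'rV[R]_n.
Implicit Types (A F G : set pt) (t u delta : R).

Lemma nneseries_le (u : nat -> \bar R) (x : \bar R) :
  (forall k, 0 <= u k)%E -> (forall l, \sum_(k < l) u k <= x)%E ->
  (\sum_(0 <= k <oo) u k <= x)%E.
Proof.
move=> u0 ux; apply: lime_le; first by apply: is_cvg_nneseries => k _ _; exact: u0.
by apply: nearW => l; rewrite big_mkord.
Qed.

Lemma le_nneseries (u : nat -> \bar R) l : (forall k, 0 <= u k)%E ->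
  (\sum_(k < l) u k <= \sum_(0 <= k <oo) u k)%E.
Proof.
by move=> u0; rewrite -(big_mkord xpredT u); apply: nneseries_lim_ge => k _ _.
Qed.

Lemma nneseries_le_card (u : nat -> \bar R) l (x : R) : 0 <= x ->
  (forall k, 0 <= u k)%E -> (forall k, (k < l)%N -> u k <= x%:E)%E ->
  (forall k, (l <= k)%N -> u k = 0%E) ->
  (\sum_(0 <= k <oo) u k <= (l%:R * x)%:E)%E.
Proof.
move=> x0 u0 ux ul; apply: nneseries_le => // k.
apply: (@le_trans _ _ (\sum_(i < k) ((i < l)%:R * x)%:E)%E).
  apply: lee_sum => i _; case: ltnP => il; last by rewrite ul ?mul0r.
  by rewrite mul1r ux.
rewrite sumEFin lee_fin -mulr_suml ler_wpM2r// -natr_sum ler_nat.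
elim: k => [|k IH]; first by rewrite big_ord0.
rewrite big_ord_recr/=; case: ltnP => [kl|_]; last by rewrite addn0.
apply: leq_trans kl; rewrite addn1 ltnS.
rewrite -[leqRHS](card_ord k) -sum1_card.
by apply: leq_sum => i _; exact: leq_b1.
Qed.

Lemma sum_dyadic_le (e : R) l : 0 <= e -> \sum_(i < l) e / 2 ^+ i.+1 <= e.
Proof.
move=> e0; have -> : \sum_(i < l) e / 2 ^+ i.+1 = e - e / 2 ^+ l.
  elim: l => [|l IH]; first by rewrite big_ord0 expr0 divr1 subrr.
  by rewrite big_ord_recr/= IH exprS; field; rewrite expf_neq0.
by rewrite gerBl divr_ge0// exprn_ge0.
Qed.

Lemma powR_le_small u (e : R) : 0 < u -> 0 < e ->
  exists2 x0 : R, 0 < x0 & forall x, 0 <= x <= x0 -> x `^ u <= e.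
Proof.
move=> u0 e0; exists (e `^ u^-1); first exact: powR_gt0.
move=> x /andP[x0 xe]; rewrite -[leRHS](@powRr1 _ e) ?(ltW e0)//.
rewrite -(@mulVf _ u) ?gt_eqF// powRrM.
by rewrite ge0_ler_powR ?nnegrE ?powR_ge0// ltW.
Qed.

Lemma ediam_ge0 A : (0 <= ediam A)%E.
Proof. by apply: ereal_sup_ubound; left. Qed.

Lemma ediam_leP A delta : 0 <= delta ->
  (ediam A <= delta%:E)%E <-> (forall x y, A x -> A y -> eucl_dist x y <= delta).
Proof.
move=> delta0; split=> [/ereal_supP dA x y Ax Ay|dA].
  by rewrite -lee_fin; apply: dA; right; exists x, y.
apply/ereal_supP => _ [->|[x [y [Ax [Ay ->]]]]]; rewrite lee_fin//.
exact: dA.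
Qed.

Lemma ediam_fineK A delta : (ediam A <= delta%:E)%E ->
  ediam A = (fine (ediam A))%:E.
Proof.
move=> dA; rewrite fineK// ge0_fin_numE ?ediam_ge0//.
exact: le_lt_trans dA (ltry _).
Qed.

Lemma fine_ediam_ge0 A : 0 <= fine (ediam A).
Proof. exact/fine_ge0/ediam_ge0. Qed.

Lemma hterm_ge0 t A : (0 <= hterm t A)%E.
Proof. by rewrite /hterm; case: ifP => // _; rewrite lee_fin powR_ge0. Qed.

Lemma hterm_set0 t : hterm t (@set0 pt) = 0%E.
Proof. by rewrite /hterm asboolT. Qed.

Lemma htermE t A x : A x -> hterm t A = ((fine (ediam A)) `^ t)%:E.
Proof. by move=> Ax; rewrite /hterm asboolF// => A0; rewrite A0 in Ax. Qed.

Lemma hterm_le t A (d : R) : 0 <= t -> 0 <= d -> (ediam A <= d%:E)%E ->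
  (hterm t A <= (d `^ t)%:E)%E.
Proof.
move=> t0 d0 Ad; rewrite /hterm; case: ifP => _; rewrite lee_fin ?powR_ge0//.
rewrite ge0_ler_powR// ?nnegrE ?fine_ediam_ge0//.
by rewrite -lee_fin -(ediam_fineK Ad).
Qed.

Lemma ediam_cball_le (c : pt) (rho : R) : 0 <= rho ->
  (ediam (cball c rho) <= (2 * rho)%:E)%E.
Proof.
move=> rho0; apply/ediam_leP; first by rewrite mulr_ge0.
move=> x y cx cy; apply: le_trans (eucl_dist_triangle c _ _) _.
by rewrite mulr_natl mulr2n lerD// eucl_dist_sym.
Qed.

(** In positive dimension a step of length [rho] along the first axis shows that the diameter is at
    least [rho]. In dimension 0 a ball has diameter 0, and only the exponent 0 survives. *)
Lemma hterm_cball_ge t (c : pt) (rho : R) : (0 < n)%N \/ t = 0 -> 0 <= t ->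
  0 <= rho -> (((rho `^ t)%:E : \bar R) <= hterm t (cball c rho))%E.
Proof.
move=> nt t0 rho0; have cc : cball c rho c by rewrite /cball/= eucl_distxx.
rewrite (htermE _ cc) lee_fin.
have [n0|->] := nt; last by rewrite !powRr0.
rewrite ge0_ler_powR ?nnegrE ?fine_ediam_ge0//.
have dK := ediam_fineK (ediam_cball_le c rho0).
rewrite -lee_fin -dK; apply: ereal_sup_ubound; right.
pose y : pt := c + rho *: delta_mx ord0 (Ordinal n0).
have cy : eucl_dist c y = rho.
  rewrite -{1}[c]addr0 -(scaler0 _ rho) eucl_dist_homothety//.
  rewrite eucl_distE sub0r dotE (bigD1 (Ordinal n0))//= big1 => [|i i0].
    by rewrite !mxE !eqxx addr0 mulrNN mulr1 sqrtr1 mulr1.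
  by rewrite !mxE (negbTE i0) andbF oppr0 mulr0.
by exists c, y; split=> //; split; rewrite ?cy// /cball/= cy.
Qed.

(** * Lower bounds from the energy of ball covers *)

Definition eball_union (L : seq (pt * R)) : set pt :=
  [set x | exists2 b, b \in L & eball b.1 b.2 x].

(* Every family of balls covering [F], grouped into countably many finite lists,
   has a finite subfamily of energy at least [c]. *)
Definition ball_energy (c t : R) F := forall L : nat -> seq (pt * R),
  (forall i b, b \in L i -> 0 < b.2) ->
  F `<=` \bigcup_i eball_union (L i) ->
  exists l, c <= \sum_(b <- flatten [seq L i | i <- iota 0 l]) b.2 `^ t.

Lemma big_flatten_iota (L : nat -> seq (pt * R)) l t :
  \sum_(b <- flatten [seq L i | i <- iota 0 l]) b.2 `^ t =
  \sum_(i < l) \sum_(b <- L i) b.2 `^ t.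
Proof. by rewrite big_flatten big_map -{1}[l]subn0 big_mkord. Qed.

(** The common engine of the lower bounds on Hausdorff and packing measures: each piece [A i] is
    replaced by finitely many balls whose energy exceeds [a] times [v i] by an error of choice, and
    [ball_energy] is applied to all these balls. A piece of infinite value makes the bound
    trivial. *)
Lemma ball_energy_series c t F (a : R) (v : nat -> \bar R) (A : nat -> set pt) :
  ball_energy c t F -> 0 < c -> 0 < a -> (forall i, 0 <= v i)%E ->
  F `<=` \bigcup_i A i ->
  (forall i (e : R), 0 < e -> (v i < +oo)%E -> exists L : seq (pt * R),
    [/\ forall b, b \in L -> 0 < b.2, A i `<=` eball_union L &
        \sum_(b <- L) b.2 `^ t <= a * fine (v i) + e]) ->
  ((c / 2 / a)%:E <= \sum_(0 <= i <oo) v i)%E.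
Proof.
move=> energy c0 a0 v0 FA vA.
have [[i vi]|vfin] := pselect (exists i, v i = +oo%E).
  by rewrite (@nneseries_pinfty _ _ _ i) ?leey.
have {}vfin i : (v i < +oo)%E by rewrite ltey; apply/eqP => vi; apply: vfin; exists i.
have vK i : v i = (fine (v i))%:E by rewrite fineK// ge0_fin_numE.
(* The errors add up to at most [c / 2], which leaves [c / 2] for the series. *)
have /choice[L LP] i : exists L : seq (pt * R),
    [/\ forall b, b \in L -> 0 < b.2, A i `<=` eball_union L &
        \sum_(b <- L) b.2 `^ t <= a * fine (v i) + c / 2 / 2 ^+ i.+1].
  by apply: vA => //; rewrite !divr_gt0// exprn_gt0.
have [||l] := energy L.
- by move=> i; have [] := LP i.
- by move=> x /FA[i _ Aix]; exists i => //; have [_ + _] := LP i; apply.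
rewrite big_flatten_iota => cl.
apply: le_trans (le_nneseries l v0).
under eq_bigr do rewrite vK.
rewrite sumEFin lee_fin ler_pdivrMr// [leRHS]mulrC mulr_sumr.
have : c <= \sum_(i < l) (a * fine (v i) + c / 2 / 2 ^+ i.+1).
  by apply: le_trans cl _; apply: ler_sum => i _; have [] := LP i.
rewrite big_split/=.
have : \sum_(i < l) c / 2 / 2 ^+ i.+1 <= c / 2 by rewrite sum_dyadic_le// ltW// divr_gt0.
lra.
Qed.

Lemma ball_energy_hterm c t F (W : nat -> set pt) : ball_energy c t F -> 0 < c ->
  0 <= t -> F `<=` \bigcup_i W i -> (forall i, ediam (W i) < +oo)%E ->
  ((c / 2 / 2 `^ t)%:E <= \sum_(0 <= i <oo) hterm t (W i))%E.
Proof.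
move=> energy c0 t0 FW W_fin.
have a0 : 0 < (2 : R) `^ t by exact: powR_gt0.
apply: (ball_energy_series energy c0 a0 _ FW) => [i|i e e0 _].
  exact: hterm_ge0.
have [W0|/set0P[x Wx]] := eqVneq (W i) set0.
  exists [::]; split=> //; first by rewrite W0 => x.
  by rewrite big_nil addr_ge0 ?(ltW e0)// mulr_ge0 ?powR_ge0// fine_ge0 ?hterm_ge0.
rewrite (htermE _ Wx) /=; set d := fine (ediam (W i)).
have d0 : 0 <= d := fine_ediam_ge0 _.
have dE : ediam (W i) = d%:E by rewrite fineK// ge0_fin_numE ?ediam_ge0.
(* An open ball around [x] contains [W i] once its radius exceeds [d]. Doubling [d] costs a factor
   2^t; if [d] is 0, a radius of small enough energy is taken, or the radius 1 when [t] is 0 and the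
   set counts for 1. *)
have [rho [rho0 drho rhot]] : exists rho : R,
    [/\ 0 < rho, d < rho & rho `^ t <= 2 `^ t * d `^ t + e].
  have [d_gt0|d_le0] := ltP 0 d.
    exists (2 * d); split; [by rewrite mulr_gt0|by rewrite ltr_pMl// ltr1n|].
    by rewrite powRM// lerDl ltW.
  have {d_le0 d0} -> : d = 0 by apply/eqP; rewrite eq_le d_le0.
  have [->|t_neq0] := eqVneq t 0.
    by exists 1; rewrite !powRr0 ltr01 mulr1; split=> //; rewrite lerDl ltW.
  have [|x0 x00 x0P] := @powR_le_small t e _ e0; first by rewrite lt_def t_neq0.
  exists x0; split=> //; rewrite powR0// mulr0 add0r.
  by apply: x0P; rewrite lexx ltW.
exists [:: (x, rho)]; split.
- by move=> b; rewrite inE => /eqP->.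
- move=> y Wy; exists (x, rho); first by rewrite inE.
  apply: le_lt_trans drho; have [+ _] := @ediam_leP (W i) d d0.
  by apply; rewrite ?dE.
- by rewrite big_seq1.
Qed.

Lemma ball_energy_hcontent c t F delta : ball_energy c t F -> 0 < c -> 0 <= t ->
  ((c / 2 / 2 `^ t)%:E <= hcontent delta t F)%E.
Proof.
move=> energy c0 t0; apply/ereal_infP => _ [W [FW Wd] <-].
by apply: (ball_energy_hterm energy) => // i; apply: le_lt_trans (Wd i) (ltry _).
Qed.

Lemma ball_energy_hausdorff_measure c t F : ball_energy c t F -> 0 < c -> 0 <= t ->
  ((c / 2 / 2 `^ t)%:E <= hausdorff_measure t F)%E.
Proof.
move=> energy c0 t0; apply: le_ereal_sup_tmp; exists (hcontent 1 t F).
  by exists 1 => //=.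
exact: ball_energy_hcontent.
Qed.

Lemma ball_energy_covnum c t F delta : ball_energy c t F -> 0 < c -> 0 <= t ->
  0 < delta -> ((c / 2 / 2 `^ t / delta `^ t)%:E <= covnum delta F)%E.
Proof.
move=> energy c0 t0 delta0.
apply/ereal_infP => _ [l [W [FW Wd]] <-].
rewrite lee_fin ler_pdivrMr ?powR_gt0// -lee_fin.
(* Padding by empty sets turns the finite cover into a sequence; they contribute 0 even for the
   exponent 0. *)
pose W' i := if (i < l)%N then W i else set0.
apply: (@le_trans _ _ (\sum_(0 <= i <oo) hterm t (W' i))%E).
  apply: (ball_energy_hterm energy) => // [x /FW[i /= il Wix]|i].
    by exists i => //; rewrite /W' il.
  apply: le_lt_trans (ltry delta); rewrite /W'; case: ifP => // _.
  by apply/(ediam_leP _ (ltW delta0)) => ? ? [].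
apply: nneseries_le_card => [|k|k kl|k lk]; first exact: powR_ge0.
- exact: hterm_ge0.
- by rewrite /W' kl hterm_le// ltW.
- by rewrite /W' ltnNge lk hterm_set0.
Qed.

Definition packing_net delta F (xs : seq pt) :=
  [/\ uniq xs, forall x, x \in xs -> F x & forall x y, x \in xs -> y \in xs ->
    x != y -> cball x delta `&` cball y delta = set0].

Lemma packing_net_energy t delta F xs : (0 < n)%N \/ t = 0 -> 0 <= t ->
  0 < delta -> packing_net delta F xs ->
  (((size xs)%:R * delta `^ t)%:E <= packing_pre_delta delta t F)%E.
Proof.
move=> nt t0 delta0 [xs_uniq xsF xs_disj].
pose B i := if (i < size xs)%N then Some (nth 0 xs i, delta) else None.
have packB : is_packing delta F B.
  split=> [k c rho|k l c rho c' rho' kl]; rewrite /B.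
    case: ifP => // ks [<- <-]; split; first by apply/xsF/mem_nth.
    by rewrite delta0 lexx.
  case: ifP => // ks [<- <-]; case: ifP => // ls [<- <-].
  by apply: xs_disj; rewrite ?mem_nth ?nth_uniq//; apply/eqP.
apply: le_ereal_sup_tmp; exists (\sum_(0 <= k <oo) pterm t (B k))%E.
  by exists B.
have B0 k : (0 <= pterm t (B k))%E.
  by rewrite /pterm; case: (B k) => [[c rho]|//]; exact: hterm_ge0.
apply: le_trans (le_nneseries (size xs) B0).
rewrite mulr_natl -[in X in (X%:E <= _)%E](card_ord (size xs)) -sumr_const -sumEFin.
apply: lee_sum => i _; rewrite /B ltn_ord /pterm.
by rewrite hterm_cball_ge// ltW.
Qed.

(* A maximal family of disjoint balls of radius [delta]; tripling the radii
   covers [F]. *)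
Lemma packing_net_cover t delta F (p : R) : (0 < n)%N \/ t = 0 -> 0 <= t ->
  0 < delta -> (packing_pre_delta delta t F <= p%:E)%E ->
  exists xs : seq pt, F `<=` eball_union [seq (x, 3 * delta) | x <- xs] /\
    (size xs)%:R * delta `^ t <= p.
Proof.
move=> nt t0 delta0 Fp.
have net_le xs : packing_net delta F xs -> (size xs)%:R * delta `^ t <= p.
  move=> /(packing_net_energy nt t0 delta0) xsp.
  by rewrite -lee_fin; exact: le_trans Fp.
apply: contrapT => /forallNP nocover.
(* If no net covers, each one can be enlarged by a point at distance at least [3 * delta] from its
   members, so nets of every size exist, against [net_le]. *)
have nets k : exists2 xs, packing_net delta F xs & size xs = k.
  elim: k => [|k [xs xs_net <-]]; first by exists [::].
  have [y [Fy yxs]] : exists y, F y /\ forall x, x \in xs -> 3 * delta <= eucl_dist x y.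
    apply: contrapT => /forallNP noy; apply: (nocover xs); split; last exact: net_le.
    move=> y Fy; have /not_andP[//|/existsNP[x /not_implyP[xxs xy]]] := noy y.
    exists (x, 3 * delta); first exact: map_f.
    by rewrite /eball/= ltNge; apply/negP.
  exists (y :: xs) => //; have [xs_uniq xsF xs_disj] := xs_net.
  have disj x : x \in xs -> cball x delta `&` cball y delta = set0.
    move=> /yxs xy; rewrite -subset0 => z [].
    have := eucl_dist_triangle z x y; rewrite (eucl_dist_sym z y) /cball/=; lra.
  split=> /=.
  - rewrite xs_uniq andbT; apply/negP => /yxs; rewrite eucl_distxx; lra.
  - by move=> x; rewrite inE => /orP[/eqP->|/xsF].
  move=> x z; rewrite !inE => /orP[/eqP->|xxs] /orP[/eqP->|zxs].
  - by rewrite eqxx.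
  - by rewrite setIC disj.
  - by rewrite disj.
  - exact: xs_disj.
have dt0 : 0 < delta `^ t by exact: powR_gt0.
have [xs xs_net xs_size] := nets (Num.truncn (p / delta `^ t)).+1.
have := net_le _ xs_net; rewrite xs_size -ler_pdivlMr// leNgt.
by rewrite truncnS_gt.
Qed.

Lemma packing_pre_delta_ge0 delta t F : (0 <= packing_pre_delta delta t F)%E.
Proof.
apply: le_ereal_sup_tmp; exists (\sum_(0 <= k <oo) pterm t (@None (pt * R)))%E.
  by exists (fun=> None).
by apply: nneseries_ge0.
Qed.

Lemma packing_pre_ge0 t F : (0 <= packing_pre t F)%E.
Proof. by apply/ereal_infP => _ [d _ <-]; exact: packing_pre_delta_ge0. Qed.

(** Each piece [G i] of finite premeasure is covered by the tripled balls of a maximal packing at a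
    nearly optimal [delta]; tripling the radii costs the factor 3^t. *)
Lemma ball_energy_packing_measure c t F : (0 < n)%N \/ t = 0 -> 0 <= t ->
  ball_energy c t F -> 0 < c -> ((c / 2 / 3 `^ t)%:E <= packing_measure t F)%E.
Proof.
move=> nt t0 energy c0; apply/ereal_infP => _ [G FG <-].
have a0 : 0 < (3 : R) `^ t by exact: powR_gt0.
apply: (ball_energy_series energy c0 a0 _ FG) => [i|i e e0 Gi].
  exact: packing_pre_ge0.
have e'0 : 0 < e / 3 `^ t by rewrite divr_gt0.
have Gfin : packing_pre t (G i) \is a fin_num.
  by rewrite ge0_fin_numE// packing_pre_ge0.
have [_ [delta /= delta0 <-] /ltW] := lb_ereal_inf_adherent e'0 Gfin.
rewrite -[ereal_inf _]/(packing_pre t (G i)) -[X in (X + _)%E](fineK Gfin) -EFinD.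
move=> /(packing_net_cover nt t0 delta0)[xs [Gxs xs_le]].
exists [seq (x, 3 * delta) | x <- xs]; split=> //.
  by move=> b /mapP[x _ ->]; rewrite mulr_gt0.
rewrite big_map/= big_const_seq count_predT iter_addr_0.
rewrite -(mulr_natl _ (size xs)) powRM ?(ltW delta0)// mulrCA.
apply: le_trans (ler_wpM2l (ltW a0) xs_le) _.
by rewrite mulrDr [_ * (e / _)]mulrCA divff ?gt_eqF// mulr1.
Qed.

(** * Upper bounds from covers at all small scales *)

Lemma hcontent_cover_le t delta rho F (L : seq (set pt)) : 0 <= t ->
  0 <= rho <= delta -> F `<=` [set x | exists2 A, A \in L & A x] ->
  (forall A x y, A \in L -> A x -> A y -> eucl_dist x y <= rho) ->
  (hcontent delta t F <= ((size L)%:R * rho `^ t)%:E)%E.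
Proof.
move=> t0 /andP[rho0 rhod] FL Lrho.
have dW i : (ediam (nth set0 L i) <= rho%:E)%E.
  apply/ediam_leP => // x y; have [iL|Li] := ltnP i (size L).
    exact/Lrho/mem_nth.
  by rewrite nth_default.
apply: ge_ereal_inf; exists (\sum_(0 <= k <oo) hterm t (nth set0 L k))%E.
  exists (nth set0 L) => //; split=> [x /FL[A AL Ax]|i].
    by exists (index A L) => //; rewrite nth_index.
  by apply: le_trans (dW i) _; rewrite lee_fin.
apply: nneseries_le_card => [|k|k kl|k lk]; first exact: powR_ge0.
- exact: hterm_ge0.
- exact: hterm_le.
- by rewrite nth_default ?hterm_set0.
Qed.

Definition covers_at_scales (C t D : R) F := forall rho, 0 < rho <= D ->
  exists L : seq (set pt), [/\ F `<=` [set x | exists2 A, A \in L & A x],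
    forall A x y, A \in L -> A x -> A y -> eucl_dist x y <= rho &
    (size L)%:R * rho `^ t <= C].

(** The spare exponent [u] serves twice: [u = 0] bounds the measure at [t], and for [u > 0] letting
    [rho] tend to 0 makes it vanish at [t + u]. *)
Lemma covers_hcontent C t D F u delta rho : covers_at_scales C t D F ->
  0 <= t -> 0 <= u -> 0 < rho <= D -> rho <= delta ->
  (hcontent delta (t + u) F <= (C * rho `^ u)%:E)%E.
Proof.
move=> covF t0 u0 rhoD rhod; have [L [FL dL sL]] := covF _ rhoD.
have /andP[rho0 _] := rhoD.
apply: le_trans (hcontent_cover_le (rho := rho) _ _ FL dL) _.
- exact: addr_ge0.
- by rewrite (ltW rho0).
rewrite lee_fin powRD ?(gt_eqF rho0) ?implybT// mulrA.
by rewrite ler_wpM2r ?powR_ge0.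
Qed.

Lemma covers_hausdorff_measure C t D F : covers_at_scales C t D F -> 0 <= t ->
  0 < D -> (hausdorff_measure t F <= C%:E)%E.
Proof.
move=> covF t0 D0; apply/ereal_supP => _ [delta /= delta0 <-].
rewrite -[C]mulr1 -(powRr0 (Num.min delta D)) -[t]addr0.
apply: (covers_hcontent covF) => //.
  by rewrite lt_min delta0 D0 ge_min lexx orbT.
by rewrite ge_min lexx.
Qed.

Lemma hcontent_ge0 delta t F : (0 <= hcontent delta t F)%E.
Proof.
by apply/ereal_infP => _ [U _ <-]; apply: nneseries_ge0 => k _ _; exact: hterm_ge0.
Qed.

Lemma small_factor (C u eps : R) : 0 < u -> 0 < eps ->
  exists2 x0 : R, 0 < x0 & forall x, 0 <= x <= x0 -> C * x `^ u <= eps.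
Proof.
move=> u0 eps0; have C0 : 0 < `|C| + 1 by rewrite ltr_wpDl.
have [|x0 x00 x0P] := @powR_le_small u (eps / (`|C| + 1)) u0; first by rewrite divr_gt0.
exists x0 => // x /x0P; rewrite ler_pdivlMr// mulrC => /(le_trans _); apply.
by rewrite ler_wpM2r ?powR_ge0// (le_trans (ler_norm _))// lerDl.
Qed.

Lemma covers_hausdorff_measure0 C t D F u : covers_at_scales C t D F -> 0 <= t ->
  0 < D -> 0 < u -> hausdorff_measure (t + u) F = 0%E.
Proof.
move=> covF t0 D0 u0; apply/eqP; rewrite eq_le; apply/andP; split; last first.
  by apply: le_ereal_sup_tmp; eexists; [exists 1 => //=|exact: hcontent_ge0].
apply/ereal_supP => _ [delta /= delta0 <-]; apply/lee_addgt0Pr => eps eps0.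
have [x0 x00 x0P] := small_factor C u0 eps0.
pose rho := Num.min x0 (Num.min delta D).
have rho0 : 0 < rho by rewrite !lt_min x00 delta0 D0.
apply: le_trans (covers_hcontent (rho := rho) covF t0 (ltW u0) _ _) _.
- by rewrite rho0 !ge_min lexx !orbT.
- by rewrite !ge_min lexx orbT.
rewrite add0e lee_fin x0P// (ltW rho0) ge_min lexx//.
Qed.

(** Hausdorff and packing dimension have the same shape, so an arbitrary [P] stands for either
    measure. *)
Lemma dim_le (P : R -> \bar R) t : 0 <= t -> (forall u, 0 < u -> P (t + u) = 0%E) ->
  (ereal_inf [set s%:E | s in [set s : R | (0 <= s)%R /\ P s = 0%E]] <= t%:E)%E.
Proof.
move=> t0 Pt; apply/lee_addgt0Pr => u u0; apply: ereal_inf_lbound.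
by exists (t + u) => //; split; [rewrite addr_ge0// ltW|exact: Pt].
Qed.

(** Positivity at all exponents up to [t] takes the place of monotonicity of [P]. *)
Lemma dim_ge (P : R -> \bar R) t : (forall s, 0 <= s <= t -> (0 < P s)%E) ->
  (t%:E <= ereal_inf [set s%:E | s in [set s : R | (0 <= s)%R /\ P s = 0%E]])%E.
Proof.
move=> Pt; apply/ereal_infP => _ [s [s0 Ps] <-]; rewrite lee_fin leNgt.
by apply/negP => st; have := Pt s; rewrite Ps ltxx s0 (ltW st) => /(_ isT).
Qed.

(** * Covering numbers and box dimensions *)

Lemma covers_covnum C t D F rho : covers_at_scales C t D F -> 0 < rho <= D ->
  (covnum rho F <= (C / rho `^ t)%:E)%E.
Proof.
move=> covF rhoD; have [L [FL dL sL]] := covF _ rhoD.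
have /andP[rho0 _] := rhoD.
apply: ge_ereal_inf; exists ((size L)%:R)%:E; last first.
  by rewrite lee_fin ler_pdivlMr// powR_gt0.
exists (size L) => //; exists (nth set0 L); split=> [x /FL[A AL Ax]|i].
  by exists (index A L); rewrite /= ?index_mem// nth_index.
apply/ediam_leP; first exact: ltW.
move=> x y; have [iL|Li] := ltnP i (size L); first exact/dL/mem_nth.
by rewrite nth_default.
Qed.

(** The two bounds are proved together because each excludes an infinite value, on which [fine]
    would return 0. *)
Lemma covnum_bounds C t D c t' F rho : covers_at_scales C t D F ->
  ball_energy c t' F -> 0 < c -> 0 <= t' -> 0 < rho <= D ->
  c / 2 / 2 `^ t' / rho `^ t' <= fine (covnum rho F) <= C / rho `^ t.
Proof.
move=> covF energy c0 t'0 rhoD; have /andP[rho0 _] := rhoD.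
have := covers_covnum covF rhoD; have := ball_energy_covnum energy c0 t'0 rho0.
case: (covnum rho F) => [v||]//=; rewrite ?lee_fin; first by move=> -> ->.
Qed.

(** Multiplicative constants in a covering number do not affect box dimensions: their logarithm is
    negligible against [- ln d]. Below [expR (- z)], [- ln d] exceeds [z], which is at least
    [|x| / eta]. *)
Lemma ln_small (x eta delta0 : R) : 0 < eta -> 0 < delta0 ->
  exists e : R, [/\ 0 < e < 1, e <= delta0 & forall d, 0 < d < e ->
    0 < - ln d /\ `|x| <= eta * - ln d].
Proof.
move=> eta0 delta00; pose z := (`|x| + 1) / eta.
have z0 : 0 < z by rewrite divr_gt0// ltr_wpDl.
exists (Num.min delta0 (expR (- z))).
have e1 : expR (- z) < 1 by rewrite -expR0 ltr_expR oppr_lt0.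
split; rewrite ?lt_min ?gt_min ?ge_min ?lexx ?delta00 ?expR_gt0 ?e1 ?orbT//.
move=> d /andP[d0]; rewrite lt_min => /andP[_ dz].
have : ln d < - z by rewrite -[ltRHS]expRK ltr_ln ?posrE ?expR_gt0.
rewrite ltrNr => zd; split; first exact: lt_trans zd.
rewrite mulrC -ler_pdivrMr//; apply: le_trans (ltW zd).
by rewrite /z ler_pM2r ?invr_gt0// lerDl.
Qed.

Lemma lower_box_dim_ge c t D F : 0 < c -> 0 < D ->
  (forall rho, 0 < rho <= D -> c / rho `^ t <= fine (covnum rho F)) ->
  (t%:E <= lower_box_dim F)%E.
Proof.
move=> c0 D0 cF; apply/lee_subgt0Pr => eta eta0.
have [e [/andP[e0 e1] eD eP]] := ln_small (ln c) eta0 D0.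
apply: le_ereal_sup_tmp; eexists; first by exists e => //=; rewrite e0 e1.
apply/ereal_infP => _ [d /= de <-].
have [lnd cd] := eP _ de; have /andP[d0 ltde] := de.
have dD : 0 < d <= D by rewrite d0 (le_trans (ltW ltde)).
have cv : 0 < c / d `^ t by rewrite divr_gt0// powR_gt0.
have := cF _ dD; rewrite -ler_ln ?posrE//; last exact: lt_le_trans cv (cF _ dD).
rewrite ln_div ?posrE ?powR_gt0// ln_powR => cv'.
rewrite -EFinB lee_fin /box_ratio ler_pdivlMr//; apply: le_trans cv'.
by move: cd; rewrite ler_norml => /andP[cd _]; move: cd; lra.
Qed.

Lemma upper_box_dim_le C t D F : 0 < D ->
  (forall rho, 0 < rho <= D -> 0 < fine (covnum rho F) <= C / rho `^ t) ->
  (upper_box_dim F <= t%:E)%E.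
Proof.
move=> D0 CF; apply/lee_addgt0Pr => eta eta0.
have [e [/andP[e0 e1] eD eP]] := ln_small (ln C) eta0 D0.
apply: ge_ereal_inf; eexists; first by exists e => //=; rewrite e0 e1.
apply/ereal_supP => _ [d /= de <-].
have [lnd Cd] := eP _ de; have /andP[d0 ltde] := de.
have dD : 0 < d <= D by rewrite d0 (le_trans (ltW ltde)).
have /andP[v0 vC] := CF _ dD.
have C0 : 0 < C by have := lt_le_trans v0 vC; rewrite pmulr_lgt0// invr_gt0 powR_gt0.
have cv : 0 < C / d `^ t by rewrite divr_gt0// powR_gt0.
move: vC; rewrite -ler_ln ?posrE// ln_div ?posrE ?powR_gt0// ln_powR => vC.
rewrite -EFinD lee_fin /box_ratio ler_pdivrMr//; apply: le_trans vC _.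
by move: Cd; rewrite ler_norml => /andP[_ Cd]; move: Cd; lra.
Qed.

(** The infimum and the supremum are compared through their common value at a scale below both
    thresholds. *)
Lemma lower_box_dim_le_upper F : (lower_box_dim F <= upper_box_dim F)%E.
Proof.
apply/ereal_supP => _ [e /andP[e0 e1] <-]; apply/ereal_infP => _ [e' /andP[e'0 e'1] <-].
pose d := Num.min e e' / 2.
have m0 : 0 < Num.min e e' by rewrite lt_min e0.
have d0 : 0 < d by rewrite divr_gt0.
have dm : d < Num.min e e' by rewrite ltr_pdivrMr// ltr_pMr// ltr1n.
move: (dm); rewrite lt_min => /andP[de de'].
apply: (@le_trans _ _ (box_ratio d F)%:E).
  by apply: ereal_inf_lbound; exists d => //=; rewrite d0.
by apply: ereal_sup_ubound; exists d => //=; rewrite d0.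
Qed.

(** * Upper bounds from the energy of packings *)

Definition packing_bounded (C t D : R) F := forall B, is_packing D F B -> forall l,
  \sum_(i < l) (if B i is Some (_, rho) then rho `^ t else 0) <= C.

Lemma packing_pre_delta_le C t D F u delta : packing_bounded C t D F ->
  0 <= t -> 0 <= u -> delta <= D ->
  (packing_pre_delta delta (t + u) F <= (2 `^ t * C * (2 * delta) `^ u)%:E)%E.
Proof.
move=> bF t0 u0 dD; apply/ereal_supP => _ [B packB <-].
apply: nneseries_le => [k|l].
  by rewrite /pterm; case: (B k) => [[c rho]|//]; exact: hterm_ge0.
have [BF Bdisj] := packB.
have packB' : is_packing D F B.
  split=> // k c rho /BF[Fc /andP[rho0 rhod]]; split=> //.
  by rewrite rho0 (le_trans rhod).
have := bF _ packB' l => le_C.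
apply: (@le_trans _ _ (\sum_(i < l)
  (2 `^ t * (if B i is Some (_, rho) then rho `^ t else 0) * (2 * delta) `^ u)%:E)%E).
  apply: lee_sum => i _; rewrite /pterm; case E : (B i) => [[c rho]|]; last first.
    by rewrite mulr0 mul0r.
  have [_ /andP[rho0 rhod]] := BF _ _ _ E.
  (* [packing_bounded] sums powers of radii, packing sums use diameters, at most [2 * rho]; hence
     the factor 2^t. The spare power [u] is estimated at the largest radius [delta]. *)
  apply: le_trans (hterm_le _ _ (ediam_cball_le c (ltW rho0))) _.
  - exact: addr_ge0.
  - by rewrite mulr_ge0// ltW.
  have rho20 : 2 * rho != 0 by rewrite gt_eqF ?mulr_gt0.
  rewrite /= lee_fin powRD ?rho20 ?implybT// -powRM ?(ltW rho0)//.
  rewrite ler_wpM2l ?powR_ge0// ge0_ler_powR ?nnegrE ?mulr_ge0 ?(ltW rho0)//.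
    exact: le_trans (ltW rho0) rhod.
  by rewrite ler_pM2l.
by rewrite sumEFin lee_fin -mulr_suml -mulr_sumr ler_wpM2r ?ler_wpM2l ?powR_ge0.
Qed.

Lemma packing_pre_set0 t : packing_pre t (@set0 pt) = 0%E.
Proof.
apply/eqP; rewrite eq_le packing_pre_ge0 andbT.
apply: ge_ereal_inf; exists (packing_pre_delta 1 t (@set0 pt)); first by exists 1 => //=.
apply/ereal_supP => _ [B [B0 _] <-]; apply: nneseries_le => [k|l].
  by rewrite /pterm; case: (B k) => [[c rho]|//]; exact: hterm_ge0.
rewrite big1// => i _; rewrite /pterm; case E : (B i) => [[c rho]|//].
by have [] := B0 _ _ _ E.
Qed.

Lemma packing_measure_le_pre t F : (packing_measure t F <= packing_pre t F)%E.
Proof.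
pose G (i : nat) : set pt := if i is 0%N then F else set0.
apply: ge_ereal_inf; exists (\sum_(0 <= k <oo) packing_pre t (G k))%E.
  by exists G => // x Fx; exists 0%N.
apply: nneseries_le => [k|[|l]]; first exact: packing_pre_ge0.
  by rewrite big_ord0 packing_pre_ge0.
rewrite big_ord_recl/= big1 ?adde0// => i _; exact: packing_pre_set0.
Qed.

Lemma packing_bounded_measure C t D F : packing_bounded C t D F -> 0 <= t -> 0 < D ->
  (packing_measure t F <= (2 `^ t * C)%:E)%E.
Proof.
move=> bF t0 D0; apply: le_trans (packing_measure_le_pre _ _) _.
apply: ge_ereal_inf; exists (packing_pre_delta D t F); first by exists D.
have := packing_pre_delta_le bF t0 (lexx 0) (lexx D).
by rewrite addr0 powRr0 mulr1.
Qed.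

Lemma packing_bounded_measure0 C t D F u : packing_bounded C t D F -> 0 <= t ->
  0 < D -> 0 < u -> packing_measure (t + u) F = 0%E.
Proof.
move=> bF t0 D0 u0; apply/eqP; rewrite eq_le; apply/andP; split; last first.
  apply/ereal_infP => _ [G _ <-]; apply: nneseries_ge0 => k _ _.
  exact: packing_pre_ge0.
apply: le_trans (packing_measure_le_pre _ _) _; apply/lee_addgt0Pr => eps eps0.
have [x0 x00 x0P] := small_factor (2 `^ t * C) u0 eps0.
pose delta := Num.min (x0 / 2) D.
have delta0 : 0 < delta by rewrite lt_min D0 divr_gt0.
apply: ge_ereal_inf; exists (packing_pre_delta delta (t + u) F).
  by exists delta.
apply: le_trans (packing_pre_delta_le bF t0 (ltW u0) _) _.
  by rewrite ge_min lexx orbT.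
rewrite add0e lee_fin x0P// mulr_ge0 ?(ltW delta0)//=.
by rewrite mulrC -ler_pdivlMr// ge_min lexx.
Qed.

End FractalMeasures.

(** * Mass of words and cylinders at a given scale *)

Section MoranCuts.
Context {R : realType} {n N : nat}.
Local Notation pt := 'rV[R]_n.
Unset Implicit Arguments.
Variables (m : 'I_N -> nat) (S : forall i : 'I_N, 'I_(m i) -> pt -> pt).
Variables (r : forall i : 'I_N, 'I_(m i) -> R) (s : 'I_N -> R) (K : set pt).
Hypothesis r01 : forall i j, 0 < r i j < 1.
Hypothesis simS : forall i j, similarity (r i j) (S i j).
Hypothesis SK : forall i j, S i j @` K `<=` K.
Hypothesis sum_r : forall i, \sum_(j < m i) r i j `^ s i = 1.
Set Implicit Arguments.
Implicit Types (w : nat -> 'I_N) (k : nat) (f g h : pt -> pt).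
Implicit Types phi psi : (pt -> pt) -> R.

Definition shift w : nat -> 'I_N := fun k => w k.+1.

Let r_gt0 i j : 0 < r i j. Proof. by have /andP[] := r01 i j. Qed.
Let r_le1 i j : r i j <= 1. Proof. by have /andP[_ /ltW] := r01 i j. Qed.

(* The integral of [phi] over the words [e] of length [k], each word weighing
   the product of the [r i j `^ s i] along it and [phi] being evaluated at the
   corresponding composition of the maps [S]. *)
Fixpoint mass k w phi : R :=
  if k is k'.+1 then
    \sum_(j < m (w 0%N))
      r (w 0%N) j `^ s (w 0%N) *
      mass k' (shift w) (fun g => phi (S (w 0%N) j \o g))
  else phi id.

Lemma level_subK k w : rifs_level S K k w `<=` K.
Proof.
elim: k w => [|k IH] w x /=; first by [].
by case=> j _ [y ky <-]; apply: (SK (w 0%N) j); exists y => //; exact: IH ky.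
Qed.

Lemma level_decr k w : rifs_level S K k.+1 w `<=` rifs_level S K k w.
Proof.
elim: k w => [|k IH] w; first exact: (@level_subK 1).
by move=> x [j _ [y ky <-]]; exists j => //; exists y => //; exact: IH.
Qed.

Lemma level_nonincr k l w : (k <= l)%N ->
  rifs_level S K l w `<=` rifs_level S K k w.
Proof.
elim: l => [|l IH]; first by rewrite leqn0 => /eqP->.
rewrite leq_eqVlt => /orP[/eqP->//|/IH]; apply: subset_trans.
exact: level_decr.
Qed.

(** Every composition that [mass k w] integrates sends [K] into the level set, so comparison on such
    maps suffices. *)
Lemma mass_le k w phi psi :
  (forall g, g @` K `<=` rifs_level S K k w -> phi g <= psi g) ->
  mass k w phi <= mass k w psi.
Proof.
elim: k w phi psi => [|k IH] w phi psi le_phi /=.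
  by apply: le_phi => x [y Ky <-].
apply: ler_sum => j _; rewrite ler_wpM2l ?powR_ge0//; apply: IH => g gK.
apply: le_phi => x [y Ky <-]; exists j => //.
by exists (g y) => //; apply: gK; exists y.
Qed.

Lemma mass_cst k w c : mass k w (fun=> c) = c.
Proof.
elim: k w => [//|k IH] w /=; under eq_bigr do rewrite IH.
by rewrite -mulr_suml sum_r mul1r.
Qed.

Lemma massN k w phi : mass k w (fun g => - phi g) = - mass k w phi.
Proof.
elim: k w phi => [//|k IH] w phi /=; rewrite -sumrN.
by apply: eq_bigr => j _; rewrite -mulrN -IH.
Qed.

Lemma mass_sum I (L : seq I) (phi : I -> (pt -> pt) -> R) k w :
  mass k w (fun g => \sum_(b <- L) phi b g) = \sum_(b <- L) mass k w (phi b).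
Proof.
elim: k w phi => [//|k IH] w phi /=; rewrite exchange_big/=.
by apply: eq_bigr => j _; rewrite IH mulr_sumr.
Qed.

(* The cylinders at scale [rho]: words are cut as soon as the ratio of their
   composition is at most [rho] (or at length [k]). An entry is a composition of
   the [S], its ratio and its weight. *)
Fixpoint cut k w (rho : R) : seq ((pt -> pt) * R * R) :=
  if k is k'.+1 then
    if 1 <= rho then [:: (id, 1, 1)] else
    flatten [seq [seq (S (w 0%N) j \o e.1.1, r (w 0%N) j * e.1.2,
                       r (w 0%N) j `^ s (w 0%N) * e.2)
                 | e <- cut k' (shift w) (rho / r (w 0%N) j)]
            | j <- index_enum 'I_(m (w 0%N))]
  else [:: (id, 1, 1)].

Lemma big_cut k w rho (F : (pt -> pt) * R * R -> R) : rho < 1 ->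
  \sum_(e <- cut k.+1 w rho) F e =
  \sum_(j < m (w 0%N)) \sum_(e <- cut k (shift w) (rho / r (w 0%N) j))
    F (S (w 0%N) j \o e.1.1, r (w 0%N) j * e.1.2,
       r (w 0%N) j `^ s (w 0%N) * e.2).
Proof.
move=> rho1; rewrite /= leNgt rho1/= big_flatten big_map.
by apply: eq_bigr => j _; rewrite big_map.
Qed.

(** Every entry is trivial or arises by prefixing one map to an entry for the shifted word at the
    rescaled threshold; the properties of single cylinders below follow by this induction. *)
Lemma cut_ind (P : nat -> (nat -> 'I_N) -> R -> (pt -> pt) * R * R -> Prop) :
  (forall k w rho, 1 <= rho \/ k = 0%N -> P k w rho (id, 1, 1)) ->
  (forall k w rho j e, rho < 1 ->
    P k (shift w) (rho / r (w 0%N) j) e ->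
    P k.+1 w rho (S (w 0%N) j \o e.1.1, r (w 0%N) j * e.1.2,
       r (w 0%N) j `^ s (w 0%N) * e.2)) ->
  forall k w rho e, e \in cut k w rho -> P k w rho e.
Proof.
move=> P1 PS; elim=> [|k IH] w rho e /=.
  by rewrite inE => /eqP ->; apply: P1; right.
case: ifPn => [rho1|]; first by rewrite inE => /eqP ->; apply: P1; left.
rewrite -ltNge => rho1 /flatten_mapP[j _ /mapP[e' e'k ->]].
by apply: PS => //; exact: IH.
Qed.

Lemma cut_similarity k w rho e : e \in cut k w rho -> similarity e.1.2 e.1.1.
Proof.
apply: (cut_ind (P := fun _ _ _ e => similarity e.1.2 e.1.1)) => [*|].
  exact: similarity_id.
by move=> ? ? ? j ? _; apply: similarity_comp; exact: simS.
Qed.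

Lemma cut_stable (U : set pt) : (forall i j, S i j @` U `<=` U) ->
  forall k w rho e, e \in cut k w rho -> e.1.1 @` U `<=` U.
Proof.
move=> SU k w rho e; apply: (cut_ind (P := fun _ _ _ e => e.1.1 @` U `<=` U)).
  by move=> ? ? ? _ x [y Uy <-].
move=> ? w' ? j ? _ eU x [y Uy <-] /=; apply: (SU _ j).
by eexists; [apply: eU; exists y|].
Qed.

Lemma cut_weight_ge0 k w rho e : e \in cut k w rho -> 0 <= e.2.
Proof.
apply: (cut_ind (P := fun _ _ _ e => 0 <= e.2)) => [*|]; first exact: ler01.
by move=> ? ? ? j ? _; apply: mulr_ge0; exact: powR_ge0.
Qed.

Lemma cut_weight_le t k w rho e : (forall i, t <= s (w i)) ->
  e \in cut k w rho -> e.2 <= e.1.2 `^ t.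
Proof.
move=> ts ek; suff [] : 0 <= e.1.2 /\ e.2 <= e.1.2 `^ t by [].
move: ts; apply: (cut_ind (P := fun _ w _ e => (forall i, t <= s (w i)) ->
   0 <= e.1.2 /\ e.2 <= e.1.2 `^ t)) ek => [*|].
  by rewrite powR1 ler01.
move=> ? w' ? j ? _ IH ts /=; have [//|a0 pa] := IH; first by move=> i; exact: ts.
have r0 := ltW (r_gt0 j); split; first exact: mulr_ge0.
rewrite powRM//; apply: (le_trans (ler_wpM2l (powR_ge0 _ _) pa)).
rewrite ler_wpM2r ?powR_ge0// ger_powR//.
by rewrite r_gt0 r_le1.
Qed.

Lemma cut_weight_ge t k w rho e : (forall i, s (w i) <= t) ->
  e \in cut k w rho -> e.1.2 `^ t <= e.2.
Proof.
move=> ts ek; suff [] : 0 <= e.1.2 /\ e.1.2 `^ t <= e.2 by [].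
move: ts; apply: (cut_ind (P := fun _ w _ e => (forall i, s (w i) <= t) ->
   0 <= e.1.2 /\ e.1.2 `^ t <= e.2)) ek => [*|].
  by rewrite powR1 ler01.
move=> ? w' ? j ? _ IH ts /=; have [//|a0 pa] := IH; first by move=> i; exact: ts.
have r0 := ltW (r_gt0 j); split; first exact: mulr_ge0.
rewrite powRM//; apply: (le_trans _ (ler_wpM2l (powR_ge0 _ _) pa)).
rewrite ler_wpM2r ?powR_ge0// ger_powR//.
by rewrite r_gt0 r_le1.
Qed.

(** After [k] letters a ratio is at most [rmax ^+ k], so at this depth even words cut by their
    length have ratio at most [rho]. *)
Lemma cut_ratio_le rmax k w rho e : (forall i j, r i j <= rmax) ->
  rmax ^+ k <= rho -> e \in cut k w rho -> e.1.2 <= rho.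
Proof.
move=> le_rmax krho ek; move: krho.
apply: (cut_ind (P := fun k _ rho e => rmax ^+ k <= rho -> e.1.2 <= rho)) ek.
  by move=> ? ? ? [//|->]; rewrite expr0.
move=> k' w' rho' j e' _ IH krho /=.
rewrite mulrC -ler_pdivlMr//; apply: IH; rewrite ler_pdivlMr//.
apply: le_trans krho; rewrite exprSr ler_wpM2l// exprn_ge0//.
exact: le_trans (ltW (r_gt0 j)) (le_rmax _ _).
Qed.

(** Without its last letter a cut word still has ratio above [rho], and that letter contributes at
    least [rmin]. The condition [rmin * rho <= 1] takes care of the empty word. *)
Lemma cut_ratio_ge rmin k w rho e : 0 < rmin -> (forall i j, rmin <= r i j) ->
  0 < rho -> rmin * rho <= 1 -> e \in cut k w rho -> rmin * rho <= e.1.2.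
Proof.
move=> rmin0 ge_rmin rho0 rho1 ek; move: rho0 rho1.
apply: (cut_ind (P := fun _ _ rho e =>
  0 < rho -> rmin * rho <= 1 -> rmin * rho <= e.1.2)) ek => [//|].
move=> k' w' rho' j e' rho1 IH rho0 _ /=.
have : rmin * (rho' / r (w' 0%N) j) <= e'.1.2.
  apply: IH; first by rewrite divr_gt0.
  rewrite mulrA ler_pdivrMr// mul1r; apply: le_trans (ge_rmin _ j).
  by rewrite ler_piMr// ltW.
by rewrite mulrA ler_pdivrMr// [leRHS]mulrC.
Qed.

(** If further letters can only lower [phi], stopping early overestimates it, since the letters
    dropped after the cut have total mass 1. *)
Lemma mass_le_cut k w rho phi :
  (forall g h, h @` K `<=` K -> phi (g \o h) <= phi g) ->
  mass k w phi <= \sum_(e <- cut k w rho) e.2 * phi e.1.1.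
Proof.
elim: k w rho phi => [|k IH] w rho phi phi_le; first by rewrite /= big_seq1 mul1r.
have [rho1|rho1] := leP 1 rho.
  rewrite [cut _ _ _]/= rho1 big_seq1 mul1r -[leRHS](mass_cst k.+1 w).
  apply: mass_le => g gK; apply: (phi_le id g).
  exact: subset_trans gK (@level_subK _ _).
rewrite big_cut//=; apply: ler_sum => j _.
under eq_bigr do rewrite -mulrA.
rewrite -mulr_sumr ler_wpM2l ?powR_ge0//; apply: IH => g h hK.
exact: (phi_le (S (w 0%N) j \o g) h).
Qed.

Lemma cut_le_mass k w rho phi :
  (forall g h, h @` K `<=` K -> phi g <= phi (g \o h)) ->
  \sum_(e <- cut k w rho) e.2 * phi e.1.1 <= mass k w phi.
Proof.
move=> phi_ge; rewrite -lerN2 -massN -sumrN.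
under eq_bigr do rewrite -mulrN.
by apply: mass_le_cut => g h /phi_ge; rewrite lerN2.
Qed.

Lemma sum_cut_weight k w rho : \sum_(e <- cut k w rho) e.2 <= 1.
Proof.
rewrite -[leRHS](mass_cst k w).
have := @cut_le_mass k w rho (fun=> 1) (fun _ _ _ => lexx 1).
by under eq_bigr do rewrite mulr1.
Qed.

Lemma level_sub_cut k w rho x : rifs_level S K k w x ->
  exists2 e, e \in cut k w rho & (e.1.1 @` K) x.
Proof.
elim: k w rho x => [|k IH] w rho x kx.
  by exists (id, 1, 1); rewrite ?inE//; exists x.
have [rho1|rho1] := leP 1 rho.
  exists (id, 1, 1); rewrite /= ?rho1 ?inE//; exists x => //.
  exact: (level_subK kx).
have [j _ [y /(IH _ (rho / r (w 0%N) j))[e ek [z Kz <-]] <-]] := kx.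
exists (S (w 0%N) j \o e.1.1, r (w 0%N) j * e.1.2,
        r (w 0%N) j `^ s (w 0%N) * e.2); last by exists z.
rewrite /= leNgt rho1/=; apply/flatten_mapP; exists j; first exact: mem_index_enum.
by apply/mapP; exists e.
Qed.

(** Only one first letter can have [q] in its image of [U]; by injectivity its map can be stripped
    off, and induction applies to the preimage of [q]. Counting with indicators allows summation
    over several points. *)
Lemma cut_disjoint (U : set pt) k w rho q :
  (forall i, (forall j, S i j @` U `<=` U) /\
     (forall j j', j != j' -> S i j @` U `&` S i j' @` U = set0)) ->
  \sum_(e <- cut k w rho) (`[< (e.1.1 @` U) q >])%:R <= 1 :> R.
Proof.
move=> oscU; elim: k w rho q => [|k IH] w rho q.
  by rewrite /= big_seq1 -[leRHS]/1%:R ler_nat leq_b1.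
have [rho1|rho1] := leP 1 rho.
  by rewrite /= rho1 big_seq1 -[leRHS]/1%:R ler_nat leq_b1.
rewrite big_cut//=; set i := w 0%N.
have SU := (oscU i).1; have disjU := (oscU i).2.
have stable := @cut_stable U (fun i' => (oscU i').1).
have zero j : ~ (S i j @` U) q ->
    \sum_(e <- cut k (shift w) (rho / r i j))
      (`[< ((S i j \o e.1.1) @` U) q >])%:R = 0 :> R.
  move=> qj; rewrite big_seq big1// => e ek.
  case: asboolP => // -[y Uy] /= qy; case: qj; exists (e.1.1 y) => //.
  by apply: (stable _ _ _ _ ek); exists y.
have [[j [y Uy yq]]|noj] := pselect (exists j, (S i j @` U) q); last first.
  by rewrite big1 ?ler01// => j _; apply: zero => qj; apply: noj; exists j.
rewrite (bigD1 j)//= [X in _ + X]big1 ?addr0.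
  apply: le_trans (IH (shift w) (rho / r i j) y); apply: ler_sum => e _.
  rewrite ler_nat; case: asboolP => // -[z Uz /= zq].
  case: asboolP => // -[]; exists z => //; apply: (similarity_inj (simS i j)).
  by rewrite zq yq.
move=> j' j'j; apply: zero => qj'.
have := disjU _ _ j'j; rewrite -subset0 => /(_ q); apply; split => //.
by exists y.
Qed.

(** * Mass of balls, covers and packings of the attractor *)

Variables (D rmin rmax a0 : R) (o : pt) (U : set pt).
Hypothesis cK : compact K.
Hypothesis D0 : 0 < D.
Hypothesis diamK : forall x y, K x -> K y -> eucl_dist x y <= D.
Hypothesis rmin0 : 0 < rmin.
Hypothesis rmin1 : rmin <= 1.
Hypothesis ge_rmin : forall i j, rmin <= r i j.
Hypothesis rmax01 : 0 <= rmax < 1.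
Hypothesis le_rmax : forall i j, r i j <= rmax.
Hypothesis a00 : 0 < a0.
Hypothesis oU : eball o a0 `<=` U.
Hypothesis UK : U `<=` K.
Hypothesis oscU : forall i, (forall j, S i j @` U `<=` U) /\
  (forall j j', j != j' -> S i j @` U `&` S i j' @` U = set0).

Let Ko : K o.
Proof. by apply/UK/oU; rewrite /eball/= eucl_distxx. Qed.

Lemma level_compact k w : compact (rifs_level S K k w).
Proof.
elim: k w => [//|k IH] w /=; 
rewrite (_ : setT = [set` index_enum 'I_(m (w 0%N))]); last first.
  by apply/seteqP; split=> // j _ /=; exact: mem_index_enum.
rewrite bigcup_seq; apply: bigsetU_compact => j _; apply: continuous_compact; last exact: IH.
apply: continuous_subspaceT; exact: similarity_continuous (simS _ j).
Qed.

(** Otherwise each level [l] has a point outside the first [l] open sets. A cluster point of these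
    lies in all levels, which are closed and nested, hence in some [V i], which the sequence
    eventually avoids. *)
Lemma level_subcover w (V : nat -> set pt) : (forall i, open (V i)) ->
  rifs_attractor S K w `<=` \bigcup_i V i ->
  exists l, rifs_level S K l w `<=` \bigcup_(i in `I_l) V i.
Proof.
move=> oV FV; apply: contrapT => /forallNP noV.
have /choice[x xP] l : exists x,
    rifs_level S K l w x /\ forall i, (i < l)%N -> ~ V i x.
  have /existsNP[x /not_implyP[lx nVx]] := noV l.
  by exists x; split=> // i il Vix; apply: nVx; exists i.
have Fx k : (x @ \oo) (rifs_level S K k w).
  exists k => // l /= kl; apply: (level_nonincr kl); exact: (xP l).1.
have [p [Kp clp]] := @cK (x @ \oo) _ (Fx 0%N).
have Fp : rifs_attractor S K w p.
  move=> k _; have clk := compact_closed (@norm_hausdorff _ _) (@level_compact k w).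
  by apply: clk => B pB; exact: clp.
have [i _ Vip] := FV _ Fp.
have xi : (x @ \oo) (~` V i) by exists i.+1 => // l /= il; exact: (xP l).2.
by have [y [nVy Vy]] := clp _ _ xi (open_nbhs_nbhs (conj (oV i) Vip)).
Qed.

Lemma expn_le_all (L : seq R) : (forall e, e \in L -> 0 < e) ->
  exists k0, forall k, (k0 <= k)%N -> forall e, e \in L -> rmax ^+ k <= e.
Proof.
have /andP[rmax0 rmax1] := rmax01.
elim: L => [|e L IH] L0; first by exists 0%N.
have [|k1 k1P] := IH; first by move=> e' e'L; apply: L0; rewrite inE e'L orbT.
have e0 : 0 < e by apply: L0; exact: mem_head.
have [k2 k2P] : exists k, rmax ^+ k <= e.
  have : (fun k => rmax ^+ k) @ \oo --> (0 : R).
    by apply: cvg_expr; rewrite ger0_norm.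
  move=> /cvgr0Pnorm_le/(_ e e0)[k _ /(_ k (leqnn k))] /=.
  by rewrite ger0_norm ?exprn_ge0//; exists k.
exists (maxn k1 k2) => k; rewrite geq_max => /andP[k1k k2k] e'.
rewrite inE => /orP[/eqP->|]; last exact: k1P.
apply: le_trans k2P; rewrite ler_wiXn2l// ?ltW//.
Qed.

(** It can only decrease under precomposition, as [mass_le_cut] requires; [inside] can only
    increase, as [cut_le_mass] requires. *)
Definition meets (V : set pt) : (pt -> pt) -> R :=
  fun g => (`[< exists2 x, K x & V (g x) >])%:R.

(** A cylinder of scale [rho] that meets the ball has its image of [o] within [2 * rho] of [c], and
    its image of [U] contains a ball around that point large enough to hold a net point. Each net
    point lies in at most one image of [U], so at most [size Q] cylinders count. *)
Lemma mass_meets_eball : exists2 M : R, 0 < M & forall t w c rho k,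
  0 <= t -> (forall i, t <= s (w i)) -> 0 < rho -> rmax ^+ k <= rho / D ->
  mass k w (meets (eball c rho)) <= M * (rho / D) `^ t.
Proof.
have e0 : 0 < rmin * a0 / D by rewrite !mulr_gt0 ?invr_gt0.
have [Q QP] := @homothetic_net R n 2 _ (ltr0Sn _ _) e0.
exists ((size Q).+1%:R) => // t w c rho k t0 ts rho0 krho.
have rD0 : 0 < rho / D by rewrite divr_gt0.
have meets_le1 V g : meets V g <= 1 by rewrite -[leRHS]/1%:R ler_nat leq_b1.
(* Beyond the scale [D] the total mass 1 is a sufficient bound, as the successor keeps the constant
   at least 1. *)
have [rD1|rD1] := ltP 1 (rho / D).
  apply: (@le_trans _ _ 1).
    by rewrite -[leRHS](mass_cst k w); apply: mass_le => g _; exact: meets_le1.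
  rewrite -[leLHS]mulr1 ler_pM ?ler1n//.
  by rewrite -(powRr0 (rho / D)) ler_powR// ltW.
have := @mass_le_cut k w (rho / D) (meets (eball c rho)).
move=> /(_ _)/le_trans; apply.
  move=> g h hK; rewrite ler_nat; case: asboolP => // -[x Kx gh].
  by case: asboolP => // -[]; exists (h x) => //; apply: hK; exists x.
apply: (@le_trans _ _ (\sum_(e <- cut k w (rho / D)) \sum_(q <- Q)
  (rho / D) `^ t * (`[< (e.1.1 @` U) (c + rho *: q) >])%:R)).
  rewrite big_seq [leRHS]big_seq; apply: ler_sum => e ek.
  rewrite -mulr_sumr.
  have le_a : e.1.2 <= rho / D by exact: (cut_ratio_le le_rmax krho ek).
  have ge_a : rmin * (rho / D) <= e.1.2.
    apply: (cut_ratio_ge rmin0 ge_rmin rD0 _ ek).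
    by rewrite mulr_ile1 ?(ltW rmin0) ?(ltW rD0).
  have [a_gt0 sim_e] := cut_similarity ek.
  rewrite ler_pM ?(cut_weight_ge0 ek)//.
    apply: le_trans (cut_weight_le ts ek) _.
    by rewrite ge0_ler_powR// nnegrE ltW.
  rewrite /meets; case: asboolP => [[x Kx gx]|_]; last by rewrite sumr_ge0.
  have cgo : eucl_dist c (e.1.1 o) <= rho * 2.
    apply: le_trans (eucl_dist_triangle (e.1.1 x) _ _) _.
    rewrite mulr2n mulrDr mulr1 lerD ?(ltW gx)// sim_e.
    rewrite -[leRHS](@divfK _ D) ?gt_eqF// ler_pM ?eucl_dist_ge0 ?(ltW a_gt0)//.
    exact: diamK.
  have [q qQ qgo] := QP _ _ _ rho0 cgo.
  rewrite (big_rem q)//=; case: asboolP => [_|[]]; first by rewrite lerDl sumr_ge0.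
  have : eball (e.1.1 o) (e.1.2 * a0) (c + rho *: q).
    rewrite /eball/= eucl_dist_sym; apply: lt_le_trans qgo _.
    rewrite [leLHS](_ : _ = rmin * (rho / D) * a0); last by ring.
    by rewrite ler_wpM2r// ltW.
  move=> /(similarity_eball (conj a_gt0 sim_e))[z /oU Uz zq].
  by exists z.
rewrite exchange_big/=; under eq_bigr do rewrite -mulr_sumr.
rewrite -mulr_sumr mulrC ler_wpM2r ?powR_ge0//.
apply: le_trans (ler_sum _ (fun q _ => cut_disjoint k w (rho / D) _ oscU)) _.
by rewrite big_const_seq count_predT iter_addr_0 ler_nat.
Qed.

(** By compactness finitely many lists of balls cover some level; their masses add up to at least 1,
    while each is at most [M] times the power [t] of radius over [D]. *)
Lemma ball_cover_energy : exists2 M : R, 0 < M &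
  forall t w, 0 <= t -> (forall i, t <= s (w i)) ->
  ball_energy (D `^ t / M) t (rifs_attractor S K w).
Proof.
have [M M0 MP] := mass_meets_eball; exists M => // t w t0 ts L L0 FL.
have [|l lP] := level_subcover _ FL.
  move=> i; rewrite (_ : eball_union _ = \bigcup_(b in [set` L i]) eball b.1 b.2).
    by apply: bigcup_open => b _; exact: open_eball.
  by apply/seteqP; split=> x [b bL bx]; exists b.
exists l; set Lf := flatten _.
have Lf0 b : b \in Lf -> 0 < b.2 by move=> /flatten_mapP[i _ /L0].
have [|k0 k0P] := @expn_le_all [seq b.2 / D | b <- Lf].
  by move=> e /mapP[b /Lf0 b0 ->]; rewrite divr_gt0.
(* Depth [l] puts the cylinders inside the covered level, and depth [k0] makes the mass bound valid
   for all the radii at once. *)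
pose k := maxn k0 l.
have le1 : 1 <= \sum_(b <- Lf) mass k w (meets (eball b.1 b.2)).
  rewrite -mass_sum -[leLHS](mass_cst k w); apply: mass_le => g gK.
  have [i /= il [b bL gb]] : (\bigcup_(i in `I_l) eball_union (L i)) (g o).
    by apply/lP/(level_nonincr (leq_maxr k0 l))/gK; exists o.
  have bLf : b \in Lf.
    by apply/flatten_mapP; exists i => //; rewrite mem_iota.
  rewrite (big_rem b)//= -[leLHS]addr0 lerD ?sumr_ge0//.
  by rewrite /meets; case: asboolP => // -[]; exists o.
rewrite ler_pdivrMr// mulrC -[leLHS]mulr1.
apply: le_trans (ler_wpM2l (powR_ge0 _ _) le1) _.
rewrite big_seq [X in _ <= _ * X]big_seq !mulr_sumr; apply: ler_sum => b bL.
have b0 := Lf0 _ bL.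
apply: (@le_trans _ _ (D `^ t * (M * (b.2 / D) `^ t))).
  rewrite ler_wpM2l ?powR_ge0//; apply: MP => //.
  by apply: (k0P _ (leq_maxl _ _)); apply/mapP; exists b.
rewrite mulrCA -powRM ?divr_ge0 ?(ltW D0) ?(ltW b0)//.
by rewrite mulrCA divff ?mulr1// gt_eqF.
Qed.

Lemma scale_cut w (rho : R) : 0 < rho <= D -> exists k0, forall k, (k0 <= k)%N ->
  forall e, e \in cut k w (rho / D) -> rmin * (rho / D) <= e.1.2 <= rho / D.
Proof.
move=> /andP[rho0 rhoD].
have rD0 : 0 < rho / D by rewrite divr_gt0.
have [|k0 k0P] := @expn_le_all [:: rho / D].
  by move=> e; rewrite inE => /eqP->.
exists k0 => k k0k e ek; apply/andP; split; last first.
  by apply: (cut_ratio_le le_rmax _ ek); apply: k0P => //; rewrite inE.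
apply: (cut_ratio_ge rmin0 ge_rmin rD0 _ ek).
by rewrite mulr_ile1 ?(ltW rmin0) ?(ltW rD0)// ler_pdivrMr// mul1r.
Qed.

Lemma powR_scale t (rho : R) : 0 <= rho ->
  rho `^ t = (D / rmin) `^ t * (rmin * (rho / D)) `^ t.
Proof.
move=> rho0; rewrite -powRM ?mulr_ge0 ?invr_ge0 ?(ltW rmin0) ?(ltW D0)//.
by congr (_ `^ _); field; rewrite !gt_eqF.
Qed.

(** The cylinders of scale [rho] have diameter at most [rho]; each weighs at least the power [t] of
    [rmin * (rho / D)], and a total weight of at most 1 bounds their number. *)
Lemma attractor_covers t w : 0 <= t -> (forall i, s (w i) <= t) ->
  covers_at_scales ((D / rmin) `^ t) t D (rifs_attractor S K w).
Proof.
move=> t0 ts rho rhoD; have [k kP] := scale_cut w rhoD; have {kP} := kP _ (leqnn k).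
move=> kP; have /andP[rho0 _] := rhoD.
have rD0 : 0 < rho / D by rewrite divr_gt0.
have q0 := ltW (mulr_gt0 rmin0 rD0).
exists [seq e.1.1 @` K | e <- cut k w (rho / D)]; split.
- move=> x Fx; have [e ek ex] := level_sub_cut (rho / D) (Fx k I).
  by exists (e.1.1 @` K) => //; apply/mapP; exists e.
- move=> A _ _ /mapP[e ek ->] [x Kx <-] [y Ky <-].
  have [a_gt0 ->] := cut_similarity ek; have /andP[_ ae] := kP _ ek.
  by rewrite -[leRHS](@divfK _ D) ?gt_eqF// ler_pM ?eucl_dist_ge0 ?(ltW a_gt0)// diamK.
- rewrite (powR_scale _ (ltW rho0)) mulrCA -[leRHS]mulr1 ler_wpM2l ?powR_ge0//.
  rewrite size_map; apply: le_trans (sum_cut_weight k w (rho / D)).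
  rewrite -sum1_size natr_sum mulr_suml big_seq [leRHS]big_seq.
  apply: ler_sum => e ek; rewrite mul1r; have /andP[ae _] := kP _ ek.
  apply: le_trans (cut_weight_ge ts ek).
  by rewrite ge0_ler_powR// nnegrE// (le_trans q0 ae).
Qed.

Definition inside (V : set pt) : (pt -> pt) -> R :=
  fun g => (`[< g @` K `<=` V >])%:R.

(** The cylinder through the centre of a ball of radius [rho] has diameter at most [rho], so it lies
    in the ball and gives it mass. As the balls are disjoint, these masses add up to at most 1. *)
Lemma attractor_packing_bounded t w : 0 <= t -> (forall i, s (w i) <= t) ->
  packing_bounded ((D / rmin) `^ t) t D (rifs_attractor S K w).
Proof.
move=> t0 ts B [BF Bdisj] l.
pose psi i := if B i is Some (c, rho) then inside (cball c rho) else (fun=> 0).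
rewrite (eq_bigr (fun i : 'I_l => (D / rmin) `^ t *
    (if B i is Some (c, rho) then (rmin * (rho / D)) `^ t else 0))); last first.
  move=> i _; case: (B i) (BF i) => [[c rho] /(_ _ _ erefl)[_ /andP[rho0 _]]|_].
    by rewrite (powR_scale _ (ltW rho0)).
  by rewrite mulr0.
rewrite -mulr_sumr -[leRHS]mulr1 ler_wpM2l ?powR_ge0//.
have /choice[k0 k0P] (i : nat) : exists k0, forall c rho, B i = Some (c, rho) ->
    forall k, (k0 <= k)%N -> forall e, e \in cut k w (rho / D) ->
    rmin * (rho / D) <= e.1.2 <= rho / D.
  case: (B i) (BF i) => [[c rho] /(_ _ _ erefl)[_ rhoD]|_]; last by exists 0%N.
  by have [k0 k0P] := scale_cut w rhoD; exists k0 => c' rho' [_ <-].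
(* One depth for the first [l] balls, so that their masses are integrals over the same words. *)
pose k := \max_(i < l) k0 i.
apply: (@le_trans _ _ (\sum_(i < l) mass k w (psi i))).
  apply: ler_sum => i _; rewrite /psi.
  case E : (B i) => [[c rho]|]; last by rewrite mass_cst.
  have [Fc /andP[rho0 _]] := BF _ _ _ E.
  have rD0 : 0 < rho / D by rewrite divr_gt0.
  have q0 := ltW (mulr_gt0 rmin0 rD0).
  have kP := k0P _ _ _ E k (leq_bigmax i).
  have [e ek ec] := level_sub_cut (rho / D) (Fc k I).
  have /andP[ae ea] := kP _ ek.
  apply: le_trans (cut_le_mass k w (rho / D) _); last first.
    move=> g h hK; rewrite ler_nat; case: asboolP => // gV.
    case: asboolP => // -[] x [y Ky <-] /=; apply: gV.
    by exists (h y) => //; apply: hK; exists y.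
  rewrite (big_rem e)//= -[leLHS]addr0 lerD//; last first.
    rewrite big_seq sumr_ge0// => e' /mem_rem e'k.
    by rewrite mulr_ge0 ?(cut_weight_ge0 e'k).
  rewrite /inside; case: asboolP => [_|[]].
    rewrite mulr1; apply: le_trans (cut_weight_ge ts ek).
    by rewrite ge0_ler_powR// nnegrE// (le_trans q0 ae).
  move: ec => [x Kx <-] _ [y Ky <-]; have [a_gt0 sim_e] := cut_similarity ek.
  rewrite /cball/= sim_e.
  by rewrite -[leRHS](@divfK _ D) ?gt_eqF// ler_pM ?eucl_dist_ge0 ?(ltW a_gt0)// diamK.
rewrite -mass_sum -[leRHS](mass_cst k w); apply: mass_le => g _.
have [[i gi]|nog] := pselect (exists i : 'I_l, psi i g != 0); last first.
  rewrite big1 ?ler01// => i _; apply/eqP/negPn/negP => gi.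
  by apply: nog; exists i.
rewrite (bigD1 i)//= [X in _ + X]big1 ?addr0 => [|j ji].
  rewrite /psi; case: (B i) => [[c rho]|]; last exact: ler01.
  by rewrite -[leRHS]/1%:R ler_nat leq_b1.
move: gi; rewrite /psi; case Ei : (B i) => [[c rho]|]; last by rewrite eqxx.
case Ej : (B j) => [[c' rho']|//].
rewrite /inside; case: asboolP => [gi _|_]; last by rewrite eqxx.
case: asboolP => // gj; have ij : i <> j :> nat by move/val_inj/eqP; rewrite eq_sym (negbTE ji).
have := Bdisj _ _ _ _ _ _ ij Ei Ej; rewrite -subset0 => /(_ (g o))[].
by split; [apply: gi|apply: gj]; exists o.
Qed.

End MoranCuts.

(** * Finite extrema and similarity dimensions *)

Section Preliminaries.
Context {R : realType}.

(** The default value 1 covers the empty type and yields [c <= 1]. *)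
Lemma finite_positive_lbound (T : finType) (f : T -> R) : (forall x, 0 < f x) ->
  exists c, [/\ 0 < c, c <= 1 & forall x, c <= f x].
Proof.
move=> f0; exists (\big[Order.min/1]_x f x); split.
- exact: lt_bigmin.
- exact: bigmin_le_id.
- by move=> x; exact: bigmin_le.
Qed.

Lemma sup_range_max (T : finType) (f : T -> R) i :
  (forall j, f j <= f i) -> sup (range f) = f i.
Proof.
move=> fi; have ub : ubound (range f) (f i) by move=> _ [j _ <-].
apply/eqP; rewrite eq_le; apply/andP; split.
  by apply: ge_sup => //; exists (f i), i.
by apply: ub_le_sup; [exists (f i)|exists i].
Qed.

Lemma inf_range_min (T : finType) (f : T -> R) i :
  (forall j, f i <= f j) -> inf (range f) = f i.
Proof.
move=> fi; have lb : lbound (range f) (f i) by move=> _ [j _ <-].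
apply/eqP; rewrite eq_le; apply/andP; split.
  by apply: ge_inf; [exists (f i)|exists i].
by apply: lb_le_inf => //; exists (f i), i.
Qed.

Lemma similarity_dimension_ge0 (m : nat) (r : 'I_m -> R) (s : R) :
  (0 < m)%N -> (forall j, 0 < r j < 1) -> \sum_(j < m) r j `^ s = 1 -> 0 <= s.
Proof.
move=> m0 r01 sum_r; rewrite leNgt; apply/negP => s0.
pose j := Ordinal m0; have /andP[r0 r1] := r01 j.
have le1 : r j `^ s <= 1.
  rewrite -sum_r (bigD1 j)//= lerDl sumr_ge0// => i _; exact: powR_ge0.
have ge1 : 1 <= r j `^ s.
  by rewrite -(powRr0 (r j)) ger_powR ?r0 ?ltW.
have : r j `^ s == 1 by rewrite eq_le le1.
by rewrite powR_eq1 (lt_eqF r1) ltNge (ltW r0) (lt_eqF s0).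
Qed.

(** The space is a single point, so disjointness leaves only one map, and a single ratio below 1 has
    power 1 only for the exponent 0. *)
Lemma similarity_dimension_dim0 (m : nat) (S : 'I_m -> 'rV[R]_0 -> 'rV[R]_0)
    (r : 'I_m -> R) (s : R) (U : set 'rV[R]_0) :
  (forall j, 0 < r j < 1) -> \sum_(j < m) r j `^ s = 1 -> U !=set0 ->
  (forall j j', j != j' -> S j @` U `&` S j' @` U = set0) -> s = 0.
Proof.
move=> r01 sum_r [x Ux] disj.
case: m S r r01 sum_r disj => [|[|m]] S r r01 sum_r disj.
- by move: sum_r; rewrite big_ord0 => /eqP; rewrite eq_sym oner_eq0.
- move: sum_r; rewrite big_ord1 => /eqP; have /andP[r0 r1] := r01 ord0.
  by rewrite powR_eq1 (lt_eqF r1) ltNge (ltW r0) => /eqP.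
have := disj ord0 ord_max isT; rewrite -subset0 => /(_ (S ord0 x))[].
by split; [exists x|exists x => //; apply/rowP => -[]].
Qed.

End Preliminaries.

(** * Extremal measures and dimensions of the attractors *)

Theorem theorem2p4 (R : realType) (n N : nat) (m : 'I_N -> nat)
  (S : forall i : 'I_N, 'I_(m i) -> 'rV[R]_n -> 'rV[R]_n)
  (r : forall i : 'I_N, 'I_(m i) -> R)
  (K : set 'rV[R]_n) (s : 'I_N -> R) :
  compact K ->
  (0 < N)%N ->
  (forall i, (0 < m i)%N) ->
  (forall i j, 0 < r i j < 1) ->
  (forall i j x y, eucl_dist (S i j x) (S i j y) = r i j * eucl_dist x y) ->
  (forall i j, S i j @` K `<=` K) ->
  (forall i, \sum_(j < m i) r i j `^ s i = 1) ->
  uniform_OSC S K ->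
  let smax := sup (range s) in
  let smin := inf (range s) in
  let F := rifs_attractor S K in
  [/\ (0 < ereal_sup (range (fun w => packing_measure smax (F w))))%E /\
      (ereal_sup (range (fun w => packing_measure smax (F w))) < +oo)%E,
      ereal_sup (range (fun w => packing_dim (F w))) = smax%:E /\
      ereal_sup (range (fun w => upper_box_dim (F w))) = smax%:E,
      (0 < ereal_inf (range (fun w => hausdorff_measure smin (F w))))%E /\
      (ereal_inf (range (fun w => hausdorff_measure smin (F w))) < +oo)%E &
      ereal_inf (range (fun w => hausdorff_dim (F w))) = smin%:E /\
      ereal_inf (range (fun w => lower_box_dim (F w))) = smin%:E].
Proof.
move=> cK N0 m0 r01 Sr SK sum_r [U [openU [[q Uq] [UK oscU]]]] smax smin F.
have [a0 a00 oU] := open_eball_sub openU Uq.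
have simS i j : similarity (r i j) (S i j).
  by have /andP[r0 _] := r01 i j; split=> // x y; exact: Sr.
have [D D0 diamK] := compact_eucl_bounded cK.
have [rmin [rmin0 rmin1 ge_rmin]] :=
  @finite_positive_lbound R {i : 'I_N & 'I_(m i)} (fun x => r (tag x) (tagged x))
    (fun x => (andP (r01 (tag x) (tagged x))).1).
have {}ge_rmin i j : rmin <= r i j := ge_rmin (Tagged (fun i => 'I_(m i)) j).
(* The same bound applied to [1 - r] keeps all ratios uniformly below 1. *)
have [|c [c0 c1 cP]] :=
  @finite_positive_lbound R {i : 'I_N & 'I_(m i)} (fun x => 1 - r (tag x) (tagged x)).
  by move=> x; have /andP[_ r1] := r01 (tag x) (tagged x); rewrite subr_gt0.
have rmax01 : 0 <= 1 - c < 1 by rewrite subr_ge0 c1 ltrBlDl ltrDr.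
have le_rmax i j : r i j <= 1 - c.
  by have := cP (Tagged (fun i => 'I_(m i)) j); rewrite /=; lra.
have s_ge0 i : 0 <= s i := similarity_dimension_ge0 (m0 i) (r01 i) (sum_r i).
have [M M0 energy] := ball_cover_energy r01 simS SK sum_r cK D0 diamK rmin0 rmin1
  ge_rmin rmax01 le_rmax a00 oU UK oscU.
have covers := attractor_covers r01 simS SK sum_r D0 diamK rmin0 rmin1
  ge_rmin rmax01 le_rmax.
have packings := attractor_packing_bounded r01 simS SK sum_r D0 diamK rmin0 rmin1
  ge_rmin rmax01 le_rmax a00 oU UK.
pose i0 := Ordinal N0.
have [imax _ /(_ _ isT) smaxP] := arg_maxP s (erefl : predT i0).
have [imin _ /(_ _ isT) sminP] := arg_minP s (erefl : predT i0).
have smaxE : smax = s imax by exact: sup_range_max.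
have sminE : smin = s imin by exact: inf_range_min.
have smax0 : 0 <= smax by rewrite smaxE.
have smin0 : 0 <= smin by rewrite sminE.
have le_smax w (k : nat) : s (w k) <= smax by rewrite smaxE; exact: smaxP.
have ge_smin w (k : nat) : smin <= s (w k) by rewrite sminE; exact: sminP.
pose wmax (_ : nat) := imax; pose wmin (_ : nat) := imin.
(* This is the side condition of the packing lower bounds, where balls must have diameter at least
   their radius. *)
have n_gt0 : (0 < n)%N \/ smax = 0.
  rewrite smaxE; clear -r01 sum_r oscU Uq.
  case: n S U q oscU Uq => [|d] S1 U1 q1 oscU1 Uq1; last by left.
  right; apply: (similarity_dimension_dim0 (S := S1 imax) (U := U1) (r01 imax) (sum_r imax) _ _).
    by exists q1.
  exact: (oscU1 imax).2.
have energy0 t : 0 < D `^ t / M by rewrite divr_gt0// powR_gt0.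
have lower_box t w : 0 <= t -> (forall k, t <= s (w k)) ->
    (t%:E <= lower_box_dim (F w))%E.
  move=> t0 ts; apply: (@lower_box_dim_ge _ _ (D `^ t / M / 2 / 2 `^ t) _ D) => //.
    by rewrite !divr_gt0// ?powR_gt0.
  (* Covers at the exponent [smax] exist for every word; here they ensure that covering numbers are
     finite. *)
  move=> rho rhoD; have := covnum_bounds (covers smax w smax0 (le_smax w))
    (energy t w t0 ts) (energy0 t) t0 rhoD.
  by case/andP.
have upper_box t w : 0 <= t -> (forall k, s (w k) <= t) ->
    (upper_box_dim (F w) <= t%:E)%E.
  move=> t0 ts; apply: (upper_box_dim_le (C := (D / rmin) `^ t) D0).
  (* The energy bound at the exponent 0 makes the covering numbers positive, so that their
     logarithms can be compared. *)
  move=> rho rhoD; have := covnum_bounds (covers t w t0 ts)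
    (energy 0 w (lexx 0) (fun k => s_ge0 (w k))) (energy0 0) (lexx 0) rhoD.
  move=> /andP[lb ->]; rewrite andbT; apply: lt_le_trans lb.
  by have /andP[rho0 _] := rhoD; rewrite !divr_gt0// ?powR_gt0.
have packing_dim_wmax : (smax%:E <= packing_dim (F wmax))%E.
  apply: dim_ge => t /andP[t0 tsmax].
  have nt : (0 < n)%N \/ t = 0.
    case: n_gt0 => [|smax_eq0]; [by left|right].
    by apply/eqP; rewrite eq_le t0 -smax_eq0 tsmax.
  apply: lt_le_trans (ball_energy_packing_measure nt t0 _ (energy0 t)).
    by rewrite lte_fin !divr_gt0// powR_gt0.
  by apply: energy => // k; rewrite /wmax -smaxE.
split; split.
- apply: lt_le_trans (ereal_sup_ubound (imageT _ wmax)).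
  apply: lt_le_trans (ball_energy_packing_measure n_gt0 smax0 _ (energy0 smax)).
    by rewrite lte_fin !divr_gt0// powR_gt0.
  by apply: energy => // k; rewrite /wmax -smaxE.
- apply: le_lt_trans (ltry (2 `^ smax * (D / rmin) `^ smax)).
  apply/ereal_supP => _ [w _ <-].
  exact: packing_bounded_measure (packings _ _ smax0 (le_smax w)) smax0 D0.
- apply/eqP; rewrite eq_le; apply/andP; split; last first.
    exact: le_trans packing_dim_wmax (ereal_sup_ubound (imageT _ wmax)).
  apply/ereal_supP => _ [w _ <-]; apply: dim_le => // u u0.
  exact: packing_bounded_measure0 (packings _ _ smax0 (le_smax w)) smax0 D0 u0.
- apply/eqP; rewrite eq_le; apply/andP; split.
    by apply/ereal_supP => _ [w _ <-]; exact: upper_box.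
  apply: le_trans (ereal_sup_ubound (imageT _ wmax)).
  apply: le_trans (lower_box_dim_le_upper _).
  by apply: lower_box => // k; rewrite smaxE.
- apply: (@lt_le_trans _ _ (D `^ smin / M / 2 / 2 `^ smin)%:E).
    by rewrite lte_fin !divr_gt0// powR_gt0.
  apply/ereal_infP => _ [w _ <-].
  exact: ball_energy_hausdorff_measure (energy _ _ smin0 (ge_smin w)) (energy0 _) smin0.
- apply: le_lt_trans (ereal_inf_lbound (imageT _ wmin)) _.
  apply: le_lt_trans (ltry ((D / rmin) `^ smin)).
  apply: covers_hausdorff_measure (covers _ _ smin0 _) smin0 D0 => k.
  by rewrite sminE.
- apply/eqP; rewrite eq_le; apply/andP; split.
    apply: le_trans (ereal_inf_lbound (imageT _ wmin)) _.
    apply: dim_le => // u u0.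
    apply: covers_hausdorff_measure0 (covers _ _ smin0 _) smin0 D0 u0 => k.
    by rewrite sminE.
  apply/ereal_infP => _ [w _ <-]; apply: dim_ge => t /andP[t0 tsmin].
  apply: lt_le_trans (ball_energy_hausdorff_measure _ (energy0 t) t0).
    by rewrite lte_fin !divr_gt0// powR_gt0.
  by apply: energy => // k; apply: le_trans tsmin _.
- apply/eqP; rewrite eq_le; apply/andP; split; last first.
    by apply/ereal_infP => _ [w _ <-]; exact: lower_box.
  apply: le_trans (ereal_inf_lbound (imageT _ wmin)) _.
  apply: le_trans (lower_box_dim_le_upper _) _.
  by apply: upper_box => // k; rewrite sminE.
Qed.
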